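(* There are exactly $44$ Felgenhauer–Jarvis classes of valid bands, and they are precisely the isomorphism classes of multisets $\{\!\{P_1,P_2,P_3\}\!\}$ of three partitions (repetitions allowed) of $\{1,\dots,9\}$ into three blocks of size $3$, under bijections of the base set $\{1,\dots,9\}$. That is, assigning to each valid band the isomorphism class of the multiset of its column partitions induces a bijection between the Felgenhauer–Jarvis classes of bands and the set of all isomorphism classes of such multisets, and both sets have exactly $44$ elements.
   Context: A complete Sudoku grid is a filling of a $9\times 9$ array with digits from $\{1,\dots,9\}$ such that each digit occurs exactly once in each row, in each column, and in each of the nine $3\times 3$ blocks (the blocks being the intersections of the row groups $\{1,2,3\},\{4,5,6\},\{7,8,9\}$ with the column groups $\{1,2,3\},\{4,5,6\},\{7,8,9\}$). A (valid) band is a filling of a $3\times 9$ array (thought of as the first three rows of a Sudoku grid) with digits from $\{1,\dots,9\}$ such that each digit occurs exactly once in each of the three rows and exactly once in each of the three $3\times 3$ blocks $B_1,B_2,B_3$ (columns $1$–$3$, $4$–$6$, $7$–$9$). A completion of a band is a complete Sudoku grid whose first three rows are the band. Felgenhauer–Jarvis classes: the classes of the classical Sudoku enumeration, which group together the bands admitting the same number of completions; two bands are in the same class if and only if they have the same number of completions. The column partition $P_i$ of block $B_i$ is the (unordered) partition of $\{1,\dots,9\}$ into three sets of size $3$ whose members are the sets of digits appearing in the three columns of $B_i$; the multiset of column partitions of a band is $\{\!\{P_1,P_2,P_3\}\!\}$, the unordered collection of the three column partitions counted with multiplicity. A bijection $\sigma\in S_9$ acts on partitions by applying $\sigma$ to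 every element of every part, and hence on multisets of three partitions. Two multisets of three partitions are isomorphic if some $\sigma\in S_9$ transforms one into the other. *)

(* Defs.v *)
From mathcomp Require Import all_boot all_fingroup all_algebra.
From mathcomp Require Import finmap multiset.

Set Implicit Arguments.
Unset Strict Implicit.
Unset Printing Implicit Defensive.

Local Open Scope fset_scope.
Local Open Scope mset_scope.
Local Open Scope nat_scope.

(* The digits 1..9 are encoded as 0..8; rows and columns are numbered from 0,
   so that line i belongs to the group (or block) of index i %/ 3. *)
Notation digit := 'I_9 (only parsing).
Notation grid := 'M['I_9]_9 (only parsing).
Notation band := 'M['I_9]_(3, 9) (only parsing).

Definition rows_ok m n (A : 'M['I_9]_(m, n)) : bool :=
  [forall i, forall d : digit, #|[set j | A i j == d]| == 1].

Definition columns_ok m n (A : 'M['I_9]_(m, n)) : bool :=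
  [forall j, forall d : digit, #|[set i | A i j == d]| == 1].

(* For a 3 x 9 array the only row group is r = 0, hence the bound m %/ 3. *)
Definition blocks_ok m n (A : 'M['I_9]_(m, n)) : bool :=
  [forall r : 'I_(m %/ 3), forall c : 'I_(n %/ 3), forall d : digit,
    #|[set p : 'I_m * 'I_n |
        [&& p.1 %/ 3 == r, p.2 %/ 3 == c & A p.1 p.2 == d]]| == 1].

Definition sudoku_grid (G : grid) : bool :=
  [&& rows_ok G, columns_ok G & blocks_ok G].

Definition valid_band (B : band) : bool := rows_ok B && blocks_ok B.

Definition completions (B : band) : {set grid} :=
  [set G : grid | sudoku_grid G && (@usubmx _ 3 6 9 G == B)].

Definition same_completions (B C : band) : bool :=
  #|completions B| == #|completions C|.

Definition FJ_class (B : band) : {set band} :=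
  [set C | valid_band C && same_completions B C].

Definition FJ_classes : {set {set band}} :=
  [set FJ_class B | B : band & valid_band B].

Definition partitions333 : {set {set {set digit}}} :=
  [set P | partition P [set: digit] & [forall A in P, #|A| == 3]].

Definition column_partition (B : band) (k : 'I_3) : {set {set digit}} :=
  [set [set B i j | i : 'I_3] | j : 'I_9 & j %/ 3 == k].

Definition band_mset (B : band) : {mset {set {set digit}}} :=
  seq_mset [seq column_partition B k | k : 'I_3].

Definition msets333 : {fset {mset {set {set digit}}}} :=
  [fset seq_mset (tval t) | t : 3.-tuple {set {set digit}}
                          & all (fun P => P \in partitions333) t].

Definition partition_act (s : {perm digit}) (P : {set {set digit}}) :
    {set {set digit}} :=
  [set [set s x | x in A] | A : {set digit} in P].

Definition mset_act (s : {perm digit}) (M : {mset {set {set digit}}}) :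
    {mset {set {set digit}}} :=
  seq_mset [seq partition_act s P | P <- M].

Definition mset_iso (M N : {mset {set {set digit}}}) : bool :=
  [exists s : {perm digit}, mset_act s M == N].

Definition iso_class (M : {mset {set {set digit}}}) :
    {fset {mset {set {set digit}}}} :=
  [fset N in msets333 | mset_iso M N].

Definition iso_classes : {fset {fset {mset {set {set digit}}}}} :=
  [fset iso_class M | M in msets333].

(* Main.v *)
From Stdlib Require List.
From HB Require Import structures.
Require Import Defs.
From mathcomp Require Import all_boot all_fingroup all_algebra.
From mathcomp Require Import finmap multiset.

(** In each block of a valid band a digit lies in one row and in one column,
    so a block is a pair of colourings of the nine digits by three colours,
    its row colouring [r_k] and its column colouring [c_k].  The cells of a
    block hold distinct digits exactly when [d |-> (r_k d, c_k d)] is injective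
    ([transversal]), and the rows of the band hold distinct digits exactly when
    [r_1 d], [r_2 d], [r_3 d] are distinct for every digit [d] ([rainbow]).
    Three valid bands on top of each other form a grid iff in every block the
    three column colourings are rainbow as well ([sudoku_stack]).  So, with
    [f(a, b, c)] the number of bands having column colourings [a], [b], [c]
    ([row_fillings], [card_bands_with]), a band with column colourings
    [c_1], [c_2], [c_3] has

      N(c_1, c_2, c_3) = sum f(m_1, m_2, m_3) * f(b_1, b_2, b_3)

    completions, the sum being over the colourings of the middle and bottom
    bands for which every [c_k], [m_k], [b_k] is rainbow ([completion_count],
    [card_completions]).  Both [f] and [N] are unchanged when the digits are
    permuted, when the colours of one argument are renamed and when the
    arguments are permuted, so [N] depends on the isomorphism class of the
    multiset of column partitions only ([completion_count_isomorphic]).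

    What remains is finite.  There are 44 triples of partitions, the [seeds],
    such that every triple is isomorphic to a seed ([triple_seed]), the values
    of [N] at the seeds are distinct ([residues_distinct]), and every seed is
    the triple of column partitions of a band ([seed_band]).  Then two bands
    have as many completions iff their multisets are isomorphic to the same
    seed, and both families of classes are indexed by the seeds.

    To evaluate [N], the third partition is carried to the standard one,
    [std = 000111222].  The function [f(., ., std)] takes multiples of 12 as
    values.  It is tabulated for all pairs of partitions, from five of its rows
    ([base_row], [representatives]), which the digit permutations preserving
    [std] spread to all 280 rows ([search]); exchanging two adjacent digits
    exchanges two levels of the tries that store the table ([swap_levels]).
    Among the 512 pairs [(m_3, b_3)] only 56 contribute, and up to symmetry they
    are of two kinds ([complements_std], [completion_count_std]).  Dividing the
    sum by [288 = 2 * 12 * 12] and reducing it modulo 5, 7 and 11 keeps the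
    44 values apart ([completion_residueP]).

    That the seeds represent all triples is a closure computation: from the
    seeds, the symmetries fixing two of the partitions and the exchanges of
    partitions, each followed by a normalisation of the triple, reach every
    normalised triple ([spread_seeds], [all_reached]). *)

Set Implicit Arguments.
Unset Strict Implicit.
Unset Printing Implicit Defensive.

Local Open Scope nat_scope.

(** * Words over three colours *)
Inductive trit := T0 | T1 | T2.
Definition trit_code (x : trit) : option bool :=
  match x with T0 => None | T1 => Some false | T2 => Some true end.
Definition trit_decode (o : option bool) : trit :=
  match o with None => T0 | Some false => T1 | Some true => T2 end.
Lemma trit_codeK : cancel trit_code trit_decode.
Proof. by case. Qed.
HB.instance Definition _ := Finite.copy trit (can_type trit_codeK).

Notation word := (seq trit).

Definition others (x : trit) : seq (trit * trit) :=
  match x with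
  | T0 => [:: (T1, T2); (T2, T1)]
  | T1 => [:: (T0, T2); (T2, T0)]
  | T2 => [:: (T0, T1); (T1, T0)]
  end.

(** For a colouring of the digits by the columns of a block of the top band,
    these are the possible colourings for the middle and the bottom band. *)
Fixpoint complements (c : word) : seq (word * word) :=
  if c is x :: c' then
    [seq (yz.1 :: p.1, yz.2 :: p.2) | yz <- others x, p <- complements c']
  else [:: ([::], [::])].

(** The list [h] of the images of 0, 1, ..., 8 stands for a permutation of the
    digits; it acts on colourings by composition on the right. *)
Definition permute (h : seq nat) (c : word) : word := [seq nth T0 c i | i <- h].

Definition recolour (p : trit * trit * trit) (x : trit) : trit :=
  match x with T0 => p.1.1 | T1 => p.1.2 | T2 => p.2 end.
Definition recolourings : seq (trit * trit * trit) :=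
  [:: (T0, T1, T2); (T0, T2, T1); (T1, T0, T2);
      (T1, T2, T0); (T2, T0, T1); (T2, T1, T0)].

Lemma card_trit : #|{: trit}| = 3.
Proof.
have codeK : cancel trit_decode trit_code by case=> [[]|].
by rewrite (bij_eq_card (Bijective trit_codeK codeK)) card_option card_bool.
Qed.

Definition distinct3 (x y z : trit) := [&& x != y, y != z & x != z].

Fixpoint rainbow (r q s : word) : bool :=
  match r, q, s with
  | [::], [::], [::] => true
  | x :: r', y :: q', z :: s' => distinct3 x y z && rainbow r' q' s'
  | _, _, _ => false
  end.

Lemma rainbowP r q s :
  reflect [/\ size q = size r, size s = size r &
           forall i, i < size r -> distinct3 (nth T0 r i) (nth T0 q i) (nth T0 s i)]
          (rainbow r q s).
Proof.
elim: r q s => [|x r IH] [|y q] [|z s] /=; try by (constructor; case).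
  by constructor; split.
apply: (iffP andP) => [[xyz /IH [-> -> H]]|[[Eq] [Es] H]].
  by split=> // -[|i] //=; apply: H.
by split; [apply: (H 0)|apply/IH; split=> // i; apply: (H i.+1)].
Qed.

Lemma mem_others x y z : ((y, z) \in others x) = distinct3 x y z.
Proof. by case: x y z => -[] []. Qed.

Lemma mem_complements c m b : ((m, b) \in complements c) = rainbow c m b.
Proof.
elim: c m b => [|x c IH] m b /=; first by rewrite inE; case: m b => [|? ?] [|? ?].
apply/allpairsP/idP => [[[[y z] [m' b']]] /= [Hyz Hmb [-> ->]]|].
  by rewrite -mem_others Hyz -IH Hmb.
case: m b => [//|y m] [//|z b] /andP[Hyz Hmb].
by exists ((y, z), (m, b)); rewrite /= mem_others IH.
Qed.

Lemma uniq_complements c : uniq (complements c).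
Proof.
elim: c => [//|x c IH] /=; apply: allpairs_uniq => //; first by case: x.
by move=> [[y z] [m b]] [[y' z'] [m' b']] _ _ /= [-> -> -> ->].
Qed.

Lemma mem_recolourings x y z : ((x, y, z) \in recolourings) = distinct3 x y z.
Proof. by case: x y z => -[] []. Qed.

(** The row colourings of the three blocks of a band, for [n] digits.  Listing
    them is meant for reasoning only: there are [6 ^ 9] of them for nine
    digits. *)
Fixpoint rainbows n : seq (word * word * word) :=
  if n is n'.+1 then
    [seq (p.1.1 :: t.1.1, p.1.2 :: t.1.2, p.2 :: t.2) | p <- recolourings, t <- rainbows n']
  else [:: ([::], [::], [::])].

Lemma rainbowsS n : rainbows n.+1 =
  [seq (p.1.1 :: t.1.1, p.1.2 :: t.1.2, p.2 :: t.2) | p <- recolourings, t <- rainbows n].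
Proof. by []. Qed.

Lemma mem_rainbows n r q s :
  ((r, q, s) \in rainbows n) = (size r == n) && rainbow r q s.
Proof.
elim: n r q s => [|n IH] r q s; first by rewrite inE; case: r q s => [|? ?] [|? ?] [|? ?].
rewrite rainbowsS; apply/allpairsP/idP => [[[[[x y] z] [[r' q'] s']]] /= [H1 H2 [-> -> ->]]|].
  by move: H2; rewrite IH /= eqSS -mem_recolourings H1 => /andP[-> ->].
case: r q s => [//|x r] [|y q] [|z s] //=; rewrite ?andbF // eqSS => /and3P[Hr Hx Hs].
by exists ((x, y, z), (r, q, s)); rewrite mem_recolourings IH Hr.
Qed.

Lemma uniq_rainbows n : uniq (rainbows n).
Proof.
elim: n => [//|n IH]; rewrite rainbowsS; apply: allpairs_uniq => //.
by move=> [[[x y] z] [[r q] s]] [[[x' y'] z'] [[r' q'] s']] _ _ /= [-> -> -> -> -> ->].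
Qed.

(** * Row fillings and completions *)
Definition transversal (r c : word) := uniq (zip r c).

(** The number of ways to distribute the digits over the rows of a band when
    the digits of every column are given.  The constant is locked because its
    body enumerates [rainbows 9]. *)
HB.lock Definition row_fillings (a b c : word) : nat :=
  count (fun t => [&& transversal t.1.1 a, transversal t.1.2 b & transversal t.2 c]) (rainbows 9).

Definition completion_count (a b c : word) : nat :=
  \sum_(p <- complements a) \sum_(q <- complements b) \sum_(s <- complements c)
    row_fillings p.1 q.1 s.1 * row_fillings p.2 q.2 s.2.

(** * Invariance under digits, colours and blocks *)
Lemma perm_map_stable (T : eqType) (phi : T -> T) (s : seq T) :
  uniq s -> {in s, forall x, phi x \in s} -> {in s &, injective phi} ->
  perm_eq (map phi s) s.
Proof.
move=> Us Hs inj.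
have Um : uniq (map phi s) by rewrite map_inj_in_uniq.
apply: uniq_perm => //.
have [] // := uniq_min_size Um (s2 := s).
  by move=> y /mapP[x xs ->]; apply: Hs.
by rewrite size_map.
Qed.

Section Permute.
Variable h : seq nat.
Hypothesis hP : perm_eq h (iota 0 9).

Lemma size_h : size h = 9. Proof. by rewrite (perm_size hP) size_iota. Qed.

Lemma size_permute c : size (permute h c) = 9. Proof. by rewrite size_map size_h. Qed.

Lemma h_lt i : i < 9 -> nth 0 h i < 9.
Proof.
move=> Hi; have: nth 0 h i \in h by rewrite mem_nth ?size_h.
by rewrite (perm_mem hP) mem_iota.
Qed.

Lemma nth_permute c i : i < 9 -> nth T0 (permute h c) i = nth T0 c (nth 0 h i).
Proof. by move=> Hi; rewrite (nth_map 0) ?size_h. Qed.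

Lemma h_surj i : i < 9 -> exists2 j, j < 9 & nth 0 h j = i.
Proof.
move=> Hi; have: i \in h by rewrite (perm_mem hP) mem_iota.
by move=> H; exists (index i h); rewrite ?nth_index // -size_h index_mem.
Qed.

Lemma permute_inj c c' : size c = 9 -> size c' = 9 -> permute h c = permute h c' -> c = c'.
Proof.
move=> Sc Sc' E; apply: (@eq_from_nth _ T0); rewrite Sc // => i Hi.
by have [j Hj <-] := h_surj Hi; rewrite -!nth_permute // E.
Qed.

Lemma rainbow_permute r q s : size r = 9 -> rainbow r q s ->
  rainbow (permute h r) (permute h q) (permute h s).
Proof.
move=> Sr /rainbowP[Sq Ss H]; apply/rainbowP; rewrite !size_permute; split=> // i Hi.
by rewrite !nth_permute //; apply: H; rewrite Sr h_lt.
Qed.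

Lemma perm_nth (T : eqType) (x0 : T) (w : seq T) : size w = 9 ->
  perm_eq [seq nth x0 w i | i <- h] w.
Proof.
move=> Sw; have: perm_eq [seq nth x0 w i | i <- h] [seq nth x0 w i | i <- iota 0 9].
  exact: perm_map.
by move/perm_trans; apply; rewrite -Sw map_nth_iota0 // take_size.
Qed.

Lemma transversal_permute r c : size r = 9 -> size c = 9 ->
  transversal (permute h r) (permute h c) = transversal r c.
Proof.
move=> Sr Sc; rewrite /transversal.
have Sz : size (zip r c) = 9 by rewrite size_zip Sr Sc.
rewrite -(perm_uniq (perm_nth (T0, T0) Sz)); congr uniq.
rewrite /permute zip_map; apply/eq_in_map => i.
by rewrite (perm_mem hP) mem_iota => /andP[_ Hi]; rewrite nth_zip // Sr Sc.
Qed.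

Lemma rainbow_size r q s : rainbow r q s -> size q = size r /\ size s = size r.
Proof. by case/rainbowP. Qed.

Lemma row_fillings_permute a b c : size a = 9 -> size b = 9 -> size c = 9 ->
  row_fillings (permute h a) (permute h b) (permute h c) = row_fillings a b c.
Proof.
move=> Sa Sb Sc; rewrite row_fillings.unlock.
pose phi (t : word * word * word) := (permute h t.1.1, permute h t.1.2, permute h t.2).
have Hp : perm_eq (map phi (rainbows 9)) (rainbows 9).
  apply: perm_map_stable; first exact: uniq_rainbows.
    move=> [[r q] s]; rewrite !mem_rainbows => /andP[/eqP Sr H].
    by rewrite size_permute eqxx /= rainbow_permute.
  move=> [[r q] s] [[r' q'] s']; rewrite !mem_rainbows.
  move=> /andP[/eqP Sr /rainbow_size[Sq Ss]] /andP[/eqP Sr' /rainbow_size[Sq' Ss']].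
  by case=> E1 E2 E3; congr (_, _, _); apply: permute_inj; rewrite ?Sq ?Sq' ?Ss ?Ss'.
rewrite -(seq.permP Hp) count_map; apply: eq_in_count => -[[r q] s].
rewrite mem_rainbows => /andP[/eqP Sr /rainbow_size[Sq Ss]] /=.
by rewrite !transversal_permute // ?Sq ?Ss.
Qed.

Lemma perm_complements_permute c : size c = 9 ->
  perm_eq (complements (permute h c)) [seq (permute h p.1, permute h p.2) | p <- complements c].
Proof.
move=> Sc; apply: uniq_perm; first exact: uniq_complements.
  rewrite map_inj_in_uniq ?uniq_complements // => -[m b] [m' b'].
  rewrite !mem_complements => /rainbow_size[Sm Sb] /rainbow_size[Sm' Sb'].
  by case=> E1 E2; congr (_, _); apply: permute_inj; rewrite ?Sm ?Sm' ?Sb ?Sb' ?Sc.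
move=> [m b]; apply/idP/mapP => [|[[m' b']]].
  rewrite mem_complements => /rainbowP[]; rewrite size_permute => Sm Sb H.
  pose k := [seq index i h | i <- iota 0 9].
  have kh i : i < 9 -> nth 0 k (nth 0 h i) = i.
    move=> Hi; rewrite (nth_map 0) ?size_iota ?h_lt // nth_iota ?h_lt // add0n index_uniq
      ?size_h //.
    by rewrite (perm_uniq hP) iota_uniq.
  have Sk : size k = 9 by rewrite size_map size_iota.
  have nk (w : word) i : i < 9 -> nth T0 (permute k w) (nth 0 h i) = nth T0 w i.
    by move=> Hi; rewrite /permute (nth_map 0) ?Sk ?h_lt // kh.
  have Ek (w : word) : size w = 9 -> permute h (permute k w) = w.
    move=> Sw; apply: (@eq_from_nth _ T0); rewrite size_permute ?Sw // => i Hi.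
    by rewrite nth_permute // nk.
  exists (permute k m, permute k b); last by rewrite /= !Ek.
  rewrite mem_complements; apply/rainbowP; rewrite !size_map size_iota Sc; split=> // i Hi.
  have [j Hj <-] := h_surj Hi; have := H j Hj.
  by rewrite nth_permute // !nk.
by rewrite mem_complements => H [-> ->]; rewrite mem_complements rainbow_permute.
Qed.

Lemma completion_count_permute a b c : size a = 9 -> size b = 9 -> size c = 9 ->
  completion_count (permute h a) (permute h b) (permute h c) = completion_count a b c.
Proof.
move=> Sa Sb Sc; rewrite /completion_count.
rewrite (perm_big _ (perm_complements_permute Sa)) big_map /=.
rewrite big_seq [RHS]big_seq; apply: eq_bigr => -[m b0];
  rewrite mem_complements => /rainbow_size[Sm1 Sb1].
rewrite (perm_big _ (perm_complements_permute Sb)) big_map /=.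
rewrite big_seq [RHS]big_seq; apply: eq_bigr => -[m2 b2];
  rewrite mem_complements => /rainbow_size[Sm2 Sb2].
rewrite (perm_big _ (perm_complements_permute Sc)) big_map /=.
rewrite big_seq [RHS]big_seq; apply: eq_bigr => -[m3 b3];
  rewrite mem_complements => /rainbow_size[Sm3 Sb3].
by rewrite /= !row_fillings_permute ?Sm1 ?Sm2 ?Sm3 ?Sb1 ?Sb2 ?Sb3.
Qed.
End Permute.

Section Recolour.
Variable pi : trit -> trit.
Hypothesis pi_inj : injective pi.

Lemma transversal_recolour r c : transversal r (map pi c) = transversal r c.
Proof.
have E : zip r (map pi c) = map (fun p => (p.1, pi p.2)) (zip r c).
  by elim: r c => [|x r IH] [|y c] //=; rewrite IH.
rewrite /transversal E map_inj_uniq // => -[x y] [x' y'] /= [-> /pi_inj ->] //.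
Qed.

Lemma transversal_recolour_rows r c : transversal (map pi r) c = transversal r c.
Proof.
have E : zip (map pi r) c = map (fun p => (pi p.1, p.2)) (zip r c).
  by elim: r c => [|x r IH] [|y c] //=; rewrite IH.
rewrite /transversal E map_inj_uniq // => -[x y] [x' y'] /= [/pi_inj -> ->] //.
Qed.

Lemma row_fillings_recolour1 a b c : row_fillings (map pi a) b c = row_fillings a b c.
Proof. by rewrite row_fillings.unlock; apply: eq_count => t; rewrite transversal_recolour. Qed.
Lemma row_fillings_recolour2 a b c : row_fillings a (map pi b) c = row_fillings a b c.
Proof. by rewrite row_fillings.unlock; apply: eq_count => t; rewrite transversal_recolour. Qed.
Lemma row_fillings_recolour3 a b c : row_fillings a b (map pi c) = row_fillings a b c.
Proof. by rewrite row_fillings.unlock; apply: eq_count => t; rewrite transversal_recolour. Qed.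

Lemma rainbow_recolour r q s : rainbow (map pi r) (map pi q) (map pi s) = rainbow r q s.
Proof.
elim: r q s => [|x r IH] [|y q] [|z s] //=.
by rewrite /distinct3 !(inj_eq pi_inj) IH.
Qed.

Lemma perm_complements_recolour c :
  perm_eq (complements (map pi c)) [seq (map pi p.1, map pi p.2) | p <- complements c].
Proof.
have [rho piK rhoK] := injF_bij pi_inj.
apply: uniq_perm; first exact: uniq_complements.
  rewrite map_inj_uniq ?uniq_complements // => -[m b] [m' b'] /=.
  by case=> /(inj_map pi_inj) -> /(inj_map pi_inj) ->.
move=> [m b]; apply/idP/mapP => [|[[m' b']]].
  rewrite mem_complements => H; exists (map rho m, map rho b).
    by rewrite mem_complements -rainbow_recolour !(mapK rhoK).
  by rewrite /= !(mapK rhoK).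
by rewrite mem_complements => H [-> ->]; rewrite mem_complements rainbow_recolour.
Qed.

(** Complements are recoloured along with their colouring, which [row_fillings]
    does not notice. *)
Lemma completion_count_recolour1 a b c : completion_count (map pi a) b c = completion_count a b c.
Proof.
rewrite /completion_count (perm_big _ (perm_complements_recolour a)) big_map;
  apply: eq_bigr => p _.
by do 2!apply: eq_bigr => ? _; rewrite !row_fillings_recolour1.
Qed.
End Recolour.

Lemma rainbow_swap12 r q s : rainbow r q s = rainbow q r s.
Proof.
elim: r q s => [|x r IH] [|y q] [|z s] //=; rewrite IH; congr (_ && _).
by case: x y z => -[] [].
Qed.
Lemma rainbow_swap23 r q s : rainbow r q s = rainbow r s q.
Proof.
elim: r q s => [|x r IH] [|y q] [|z s] //=; rewrite IH; congr (_ && _).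
by case: x y z => -[] [].
Qed.

Lemma row_fillings_swap12 a b c : row_fillings a b c = row_fillings b a c.
Proof.
have Hp : perm_eq (map (fun t => (t.1.2, t.1.1, t.2)) (rainbows 9)) (rainbows 9).
  apply: perm_map_stable; first exact: uniq_rainbows.
    move=> [[r q] s]; rewrite !mem_rainbows /= rainbow_swap12 => /andP[Sr H].
    by case: (rainbow_size H) Sr => <- _ ->.
  by move=> [[r q] s] [[r' q'] s'] _ _ /= [-> -> ->].
rewrite row_fillings.unlock -(seq.permP Hp) count_map; apply: eq_count => -[[r q] s] /=.
by rewrite andbCA.
Qed.

Lemma row_fillings_swap23 a b c : row_fillings a b c = row_fillings a c b.
Proof.
have Hp : perm_eq (map (fun t => (t.1.1, t.2, t.1.2)) (rainbows 9)) (rainbows 9).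
  apply: perm_map_stable; first exact: uniq_rainbows.
    by move=> [[r q] s]; rewrite !mem_rainbows /= rainbow_swap23.
  by move=> [[r q] s] [[r' q'] s'] _ _ /= [-> -> ->].
rewrite row_fillings.unlock -(seq.permP Hp) count_map; apply: eq_count => -[[r q] s] /=.
by rewrite [transversal s _ && _]andbC.
Qed.

Lemma completion_count_swap12 a b c : completion_count a b c = completion_count b a c.
Proof.
rewrite /completion_count exchange_big /=; apply: eq_bigr => p _.
by apply: eq_bigr => q _; apply: eq_bigr => s _;
  rewrite (row_fillings_swap12 p.1) (row_fillings_swap12 p.2).
Qed.

Lemma completion_count_swap23 a b c : completion_count a b c = completion_count a c b.
Proof.
rewrite /completion_count; apply: eq_bigr => p _; rewrite exchange_big /=.
by apply: eq_bigr => q _; apply: eq_bigr => s _;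
  rewrite (row_fillings_swap23 p.1) (row_fillings_swap23 p.2).
Qed.

(** * Bands and grids as colourings *)
Definition ord3 (t : trit) : 'I_3 :=
  match t with
  | T0 => @Ordinal 3 0 isT | T1 => @Ordinal 3 1 isT | T2 => @Ordinal 3 2 isT
  end.
Definition trit_of (n : nat) : trit :=
  match n with 0 => T0 | 1 => T1 | _ => T2 end.

Lemma ord3K : cancel (fun t => val (ord3 t)) trit_of. Proof. by case. Qed.
Lemma ord3_inj : injective ord3. Proof. by move=> [] []. Qed.
Lemma trit_ofK (i : 'I_3) : ord3 (trit_of i) = i.
Proof. by case: i => [[|[|[|]]]] // ?; apply: val_inj. Qed.

(** Colours number the three groups of lines and the three lines of a group
    alike: [line b r] is line [r] of group [b]. *)
Lemma line_lt b r : 3 * ord3 b + ord3 r < 9. Proof. by case: b r => -[]. Qed.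
Definition line b r : 'I_9 := Ordinal (line_lt b r).

Lemma line_div b r : trit_of (line b r %/ 3) = b. Proof. by case: b r => -[]. Qed.
Lemma line_divn b r : line b r %/ 3 = ord3 b. Proof. by case: b r => -[]. Qed.
Lemma line_mod b r : trit_of (line b r %% 3) = r. Proof. by case: b r => -[]. Qed.
Lemma lineE (j : 'I_9) : j = line (trit_of (j %/ 3)) (trit_of (j %% 3)).
Proof. by case: j => [[|[|[|[|[|[|[|[|[|]]]]]]]]]] // ?; apply: val_inj. Qed.
Lemma line_inj b r b' r' : line b r = line b' r' -> b = b' /\ r = r'.
Proof. by move=> E; rewrite -(line_div b r) -{2}(line_mod b r) E line_div line_mod. Qed.

Lemma card_trit2 : #|{: trit * trit}| = 9.
Proof. by rewrite card_prod card_trit. Qed.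

(** Nine positions and nine digits: an injective map is also onto.  All the
    Sudoku conditions become injectivity conditions in this way. *)
Lemma fibres_inj (T : finType) (f : T -> 'I_9) : #|T| = 9 ->
  [forall d, #|[set x | f x == d]| == 1] = injectiveb f.
Proof.
move=> cT; apply/idP/injectiveP => [/forallP H x y E | inj].
  have /cards1P[z Ez] := H (f y).
  have: x \in [set z] by rewrite -Ez inE E.
  have: y \in [set z] by rewrite -Ez inE.
  by rewrite !inE => /eqP -> /eqP ->.
apply/forallP => d; apply/cards1P.
have /codomP[x Ex] : d \in codom f by apply: inj_card_onto; rewrite // cT card_ord.
exists x; apply/setP => y; rewrite !inE Ex; exact: (inj_eq inj).
Qed.

(** The cells of a block are indexed by pairs of colours.  The index maps [R]
    and [C] are kept general so that the blocks of a band and those of a grid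
    are covered at once. *)
Lemma block_fibres m n (A : 'M['I_9]_(m, n)) (R : trit -> 'I_m) (C : trit -> 'I_n)
    (r c : nat) :
  injective R -> injective C ->
  (forall i : 'I_m, reflect (exists t, i = R t) (i %/ 3 == r)) ->
  (forall j : 'I_n, reflect (exists t, j = C t) (j %/ 3 == c)) ->
  [forall d : 'I_9, #|[set p : 'I_m * 'I_n |
        [&& p.1 %/ 3 == r, p.2 %/ 3 == c & A p.1 p.2 == d]]| == 1]
  = injectiveb (fun q : trit * trit => A (R q.1) (C q.2)).
Proof.
move=> Ri Ci HR HC; rewrite -(fibres_inj _ card_trit2); apply: eq_forallb => d.
pose g (q : trit * trit) := (R q.1, C q.2).
have gi : injective g by move=> [x y] [x' y'] [/Ri -> /Ci ->].
rewrite -(card_imset [set q | A (R q.1) (C q.2) == d] gi); congr (_ == _);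
  apply: eq_card => -[i j].
rewrite inE /=; apply/and3P/imsetP => [[/HR[t ->] /HC[u ->] Ad]|[[t u]]].
  by exists (t, u); rewrite ?inE.
by rewrite inE /= => Ad [-> ->]; split=> //; [apply/HR; exists t | apply/HC; exists u].
Qed.

Lemma line_fibre b (i : 'I_9) : reflect (exists t, i = line b t) (i %/ 3 == ord3 b).
Proof.
apply: (iffP eqP) => [E | [t ->]]; last by rewrite line_divn.
by exists (trit_of (i %% 3)); rewrite {1}(lineE i) E ord3K.
Qed.

Lemma ord3_fibre (i : 'I_3) : reflect (exists t, i = ord3 t) (i %/ 3 == 0).
Proof.
apply: (iffP eqP) => _; first by exists (trit_of i); rewrite trit_ofK.
by rewrite divn_small.
Qed.

Lemma valid_bandP (X : 'M['I_9]_(3, 9)) :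
  reflect ((forall i, injective (X i)) /\
           (forall k, injective (fun q : trit * trit => X (ord3 q.1) (line k q.2))))
          (valid_band X).
Proof.
have line2 k : injective (line k) by move=> r r' /line_inj[].
have Er : rows_ok X = [forall i, injectiveb (X i)].
  by apply: eq_forallb => i; rewrite -fibres_inj ?card_ord.
have Eb : blocks_ok X = [forall k, injectiveb (fun q : trit * trit => X (ord3 q.1) (line k q.2))].
  apply/forallP/forallP => [H k | H r].
    have /forallP/(_ (ord3 k)) := H (@Ordinal (3 %/ 3) 0 isT).
    by rewrite (block_fibres _ ord3_inj (@line2 k) ord3_fibre (line_fibre k)).
  apply/forallP => c; have := H (trit_of c).
  have Er0 : nat_of_ord r = 0 by case: r => [[]].
  have Ec : nat_of_ord c = ord3 (trit_of c) by rewrite (trit_ofK c).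
  rewrite Er0 [in X in _ -> X]Ec.
  by rewrite (block_fibres _ ord3_inj (@line2 _) ord3_fibre (line_fibre _)).
rewrite /valid_band Er Eb; apply: (iffP andP) => -[H1 H2]; split.
- by move=> i; apply/injectiveP; apply: (forallP H1).
- by move=> k; apply/injectiveP; apply: (forallP H2).
- by apply/forallP => i; apply/injectiveP.
- by apply/forallP => k; apply/injectiveP.
Qed.

Definition band_of (G : 'M['I_9]_9) (b : trit) : 'M['I_9]_(3, 9) :=
  \matrix_(i, j) G (line b (trit_of i)) j.
Definition grid_of (F : trit -> 'M['I_9]_(3, 9)) : 'M['I_9]_9 :=
  \matrix_(i, j) F (trit_of (i %/ 3)) (ord3 (trit_of (i %% 3))) j.

Lemma band_of_grid F b : band_of (grid_of F) b = F b.
Proof. by apply/matrixP => i j; rewrite !mxE line_div line_mod trit_ofK. Qed.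
Lemma grid_of_band G : grid_of (band_of G) = G.
Proof. by apply/matrixP => i j; rewrite !mxE ord3K -lineE. Qed.
Lemma grid_ofE F b r j : grid_of F (line b r) j = F b (ord3 r) j.
Proof. by rewrite mxE line_div line_mod. Qed.

Lemma usubmx_band (G : 'M['I_9]_9) : @usubmx _ 3 6 9 G = band_of G T0.
Proof.
apply/matrixP => i j; rewrite !mxE; congr (G _ _).
by apply: val_inj; case: i => [[|[|[|]]]].
Qed.

Lemma sudoku_gridE G :
  sudoku_grid G = [forall b, valid_band (band_of G b)] && [forall j, injectiveb (fun i => G i j)].
Proof.
have line2 k : injective (line k) by move=> r r' /line_inj[].
have Ec : columns_ok G = [forall j, injectiveb (fun i => G i j)].
  by apply: eq_forallb => j; rewrite -fibres_inj ?card_ord.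
rewrite /sudoku_grid Ec andbCA andbC; congr (_ && _).
apply/andP/forallP => [[/forallP Hr /forallP Hb] b | H].
  apply/valid_bandP; split=> [i|k].
    have := Hr (line b (trit_of i)); rewrite fibres_inj ?card_ord // => /injectiveP inj.
    by move=> j j'; rewrite !mxE => /inj.
  have /forallP/(_ (ord3 k)) := Hb (ord3 b).
  rewrite (block_fibres _ (@line2 b) (@line2 k) (line_fibre b) (line_fibre k)).
  move=> /injectiveP inj q q'; rewrite !mxE !ord3K; exact: inj.
split; apply/forallP => r.
  rewrite fibres_inj ?card_ord //; apply/injectiveP => j j'.
  have /valid_bandP[/(_ (ord3 (trit_of (r %% 3)))) inj _] := H (trit_of (r %/ 3)).
  by rewrite {1 2}(lineE r) => E; apply: inj; rewrite !mxE !ord3K.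
apply/forallP => c.
have Er : nat_of_ord r = ord3 (trit_of r) by rewrite (trit_ofK r).
have Ecc : nat_of_ord c = ord3 (trit_of c) by rewrite (trit_ofK c).
rewrite Er Ecc (block_fibres _ (@line2 _) (@line2 _) (line_fibre _) (line_fibre _)).
apply/injectiveP => q q' E.
have /valid_bandP[_ /(_ (trit_of c)) inj] := H (trit_of r).
by apply: inj; rewrite !mxE !ord3K.
Qed.

Definition word_of (w : 'I_9 -> trit) : word := [seq w d | d <- enum 'I_9].

Lemma size_word_of w : size (word_of w) = 9.
Proof. by rewrite size_map size_enum_ord. Qed.

Lemma nth_word_of w (d : 'I_9) : nth T0 (word_of w) d = w d.
Proof. by rewrite (nth_map ord0) ?size_enum_ord // nth_ord_enum. Qed.

Lemma word_of_nth (w : word) : size w = 9 -> word_of (fun d => nth T0 w d) = w.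
Proof.
by move=> Sw; rewrite -[RHS](mkseq_nth T0) Sw /mkseq -val_enum_ord -map_comp.
Qed.

Lemma eq_word_of w w' : word_of w = word_of w' -> w =1 w'.
Proof. by move=> E d; rewrite -!nth_word_of E. Qed.

Lemma rainbow_word_of (w : trit -> 'I_9 -> trit) :
  reflect (forall d, injective (w^~ d))
          (rainbow (word_of (w T0)) (word_of (w T1)) (word_of (w T2))).
Proof.
apply: (iffP (rainbowP _ _ _)) => [[_ _ H] d | H].
  have := H d; rewrite !nth_word_of size_word_of => /(_ (ltn_ord d)) /and3P[/eqP H1 /eqP H2 /eqP
    H3].
  by case=> [] [] // /esym.
rewrite !size_word_of; split=> // i Hi; rewrite -[i]/(nat_of_ord (Ordinal Hi)) !nth_word_of.
by rewrite /distinct3 !(inj_eq (H _)).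
Qed.

(** The cell of digit [d] in block [k]; the default value is never reached in a
    valid band, see [cell_pos]. *)
Definition pos (X : band) k (d : 'I_9) : trit * trit :=
  odflt (T0, T0) [pick p : trit * trit | X (ord3 p.1) (line k p.2) == d].
Definition rows (X : band) k := word_of (fun d => (pos X k d).1).
Definition cols (X : band) k := word_of (fun d => (pos X k d).2).

Section Valid.
Variable X : band.
Hypothesis vX : valid_band X.

Lemma cell_pos k d : X (ord3 (pos X k d).1) (line k (pos X k d).2) = d.
Proof.
have [_ /(_ k) inj] := valid_bandP _ vX.
have /codomP[p Ep] : d \in codom (fun q : trit * trit => X (ord3 q.1) (line k q.2)).
  by apply: inj_card_onto; rewrite // card_trit2 card_ord.
rewrite /pos; case: pickP => [q /eqP //|/(_ p)]; by rewrite -Ep eqxx.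
Qed.

Lemma pos_cell k r c : pos X k (X (ord3 r) (line k c)) = (r, c).
Proof.
have [_ /(_ k) inj] := valid_bandP _ vX.
by apply: inj; rewrite cell_pos.
Qed.

Lemma pos_inj k : injective (pos X k).
Proof. by move=> d d' E; rewrite -(cell_pos k d) E cell_pos. Qed.

Lemma rainbow_rows : rainbow (rows X T0) (rows X T1) (rows X T2).
Proof.
apply/(rainbow_word_of (fun k d => (pos X k d).1)) => d k k' E.
have [/(_ (ord3 (pos X k d).1)) inj _] := valid_bandP _ vX.
have /inj/line_inj[//] : X (ord3 (pos X k d).1) (line k (pos X k d).2)
   = X (ord3 (pos X k d).1) (line k' (pos X k' d).2).
by rewrite cell_pos E cell_pos.
Qed.

Lemma transversal_band k : transversal (rows X k) (cols X k).
Proof.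
rewrite /transversal /rows /cols /word_of zip_map map_inj_uniq ?enum_uniq // => d d' E.
by apply: (@pos_inj k); rewrite [LHS]surjective_pairing [RHS]surjective_pairing.
Qed.
End Valid.

(** Row and column colourings give the position of every digit in every
    block. *)
Lemma band_eq X Y : valid_band X -> valid_band Y ->
  (forall k, rows X k = rows Y k) -> (forall k, cols X k = cols Y k) -> X = Y.
Proof.
move=> vX vY Er Ec; apply/matrixP => i j.
rewrite (lineE j) -(trit_ofK i).
set r := trit_of i; set k := trit_of (j %/ 3); set c := trit_of (j %% 3).
have := cell_pos vY k (X (ord3 r) (line k c)).
rewrite [pos Y _ _]surjective_pairing /= -(eq_word_of (Er k)) -(eq_word_of (Ec k)).
by rewrite !pos_cell.
Qed.

Definition band_with (p : trit -> 'I_9 -> trit * trit) : band :=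
  \matrix_(i, j) odflt ord0
    [pick d | p (trit_of (j %/ 3)) d == (trit_of i, trit_of (j %% 3))].

Section BandWith.
Variable p : trit -> 'I_9 -> trit * trit.
Hypothesis p_inj : forall k, injective (p k).
Hypothesis p_rows : forall d, injective (fun k => (p k d).1).

Lemma band_withE k d : band_with p (ord3 (p k d).1) (line k (p k d).2) = d.
Proof.
rewrite mxE line_div line_mod ord3K; case: pickP => [d' /eqP E|/(_ d)].
  by apply: (@p_inj k); rewrite E -surjective_pairing.
by rewrite -surjective_pairing eqxx.
Qed.

Lemma band_with_onto r k c :
  p k (band_with p (ord3 r) (line k c)) = (r, c).
Proof.
have /codomP[d E] : (r, c) \in codom (p k).
  by apply: inj_card_onto; rewrite // card_trit2 card_ord.
by rewrite -[r]/((r, c).1) -[in line _ _]/((r, c).2) E band_withE.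
Qed.

Lemma valid_band_with : valid_band (band_with p).
Proof.
apply/valid_bandP; split=> [i j j' | k [r c] [r' c'] /= E].
  rewrite -(trit_ofK i) (lineE j) (lineE j').
  set k := trit_of (j %/ 3); set c := trit_of (j %% 3).
  set k' := trit_of (j' %/ 3); set c' := trit_of (j' %% 3) => E.
  have E1 := band_with_onto (trit_of i) k c.
  have E2 := band_with_onto (trit_of i) k' c'.
  have Ek : k = k' by apply: (@p_rows (band_with p (ord3 (trit_of i)) (line k c)));
    rewrite E1 E E2.
  by move: E1; rewrite E Ek E2 => -[->].
by rewrite -(band_with_onto r k c) E band_with_onto.
Qed.

Lemma pos_band_with k d : pos (band_with p) k d = p k d.
Proof.
rewrite -{1}(band_withE k d) pos_cell ?valid_band_with //.
by rewrite -surjective_pairing.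
Qed.
End BandWith.

Definition bands_with (a b c : word) : {set band} :=
  [set X | valid_band X & [&& cols X T0 == a, cols X T1 == b & cols X T2 == c]].

(** A band with given column colourings is a rainbow triple of row colourings
    transversal to them: [band_with] recovers the band from the positions of
    the digits, and [band_eq] shows that there is no other one. *)
Lemma card_bands_with a b c : size a = 9 -> size b = 9 -> size c = 9 ->
  #|bands_with a b c| = row_fillings a b c.
Proof.
move=> Sa Sb Sc; rewrite row_fillings.unlock -size_filter cardE.
rewrite -(size_map (fun X => (rows X T0, rows X T1, rows X T2))).
apply/perm_size/uniq_perm; last 1 first.
- move=> [[r q] s]; apply/mapP/idP => [[X]|].
    rewrite mem_enum inE => /andP[vX /and3P[/eqP Ea /eqP Eb /eqP Ec]] [-> -> ->].
    rewrite mem_filter mem_rainbows rainbow_rows // size_word_of eqxx andbT /=.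
    by rewrite -Ea -Eb -Ec !transversal_band.
  rewrite mem_filter mem_rainbows => /and3P[/and3P[/= Ta Tb Tc] /eqP Sr /[dup] R
    /rainbow_size[Sq Ss]].
  rewrite Sr in Sq Ss.
  pose rw k := match k with T0 => r | T1 => q | T2 => s end.
  pose cw k := match k with T0 => a | T1 => b | T2 => c end.
  pose p k (d : 'I_9) := (nth T0 (rw k) d, nth T0 (cw k) d).
  have Srw k : size (rw k) = 9 by case: k.
  have Scw k : size (cw k) = 9 by case: k.
  have p_inj k : injective (p k).
    have U : uniq (zip (rw k) (cw k)) by case: k.
    move=> d d' E; apply: val_inj; apply/eqP;
      rewrite -(nth_uniq (T0, T0) _ _ U) ?size_zip ?Srw ?Scw ?minnn ?(valP d) ?(valP d') //.
    by rewrite !nth_zip ?Srw ?Scw //; apply/eqP.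
  have Er (u : trit) : word_of (fun d => (p u d).1) = rw u.
    exact: (word_of_nth (Srw u)).
  have Ec (u : trit) : word_of (fun d => (p u d).2) = cw u.
    exact: (word_of_nth (Scw u)).
  have p_rows (e : 'I_9) : injective (fun u => (p u e).1).
    by apply: (rainbow_word_of (fun k d => (p k d).1)); rewrite !Er.
  have Rk k : rows (band_with p) k = rw k.
    by rewrite -Er; apply: eq_map => d; rewrite pos_band_with.
  have Ck k : cols (band_with p) k = cw k.
    by rewrite -Ec; apply: eq_map => d; rewrite pos_band_with.
  exists (band_with p); last by rewrite !Rk.
  by rewrite mem_enum inE valid_band_with // !Ck !eqxx.
- rewrite map_inj_in_uniq ?enum_uniq // => X Y; rewrite !mem_enum !inE.
  move=> /andP[vX /and3P[/eqP Xa /eqP Xb /eqP Xc]] /andP[vY /and3P[/eqP Ya /eqP Yb /eqP Yc]] [E0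
    E1 E2].
  by apply: band_eq => // -[]; rewrite ?Xa ?Xb ?Xc ?Ya ?Yb ?Yc.
- by rewrite filter_uniq ?uniq_rainbows.
Qed.

Definition stack (B X Y : band) (t : trit) : band :=
  match t with T0 => B | T1 => X | T2 => Y end.

(** The rows and blocks of the stacked grid are those of the bands.  A column
    of the grid repeats a digit iff two of the bands have this digit in the
    same column of the same block. *)
Lemma sudoku_stack B X Y : valid_band B -> valid_band X -> valid_band Y ->
  sudoku_grid (grid_of (stack B X Y)) =
  [forall k, rainbow (cols B k) (cols X k) (cols Y k)].
Proof.
move=> vB vX vY; rewrite sudoku_gridE.
have vF b : valid_band (stack B X Y b) by case: b.
have -> : [forall b, valid_band (band_of (grid_of (stack B X Y)) b)].
  by apply/forallP => b; rewrite band_of_grid.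
apply/forallP/forallP => [H k | H j].
  apply/(rainbow_word_of (fun b d => (pos (stack B X Y b) k d).2)) => d b b' E.
  have /injectiveP inj := H (line k (pos (stack B X Y b) k d).2).
  have /inj/line_inj[//] : grid_of (stack B X Y) (line b (pos (stack B X Y b) k d).1) (line k
    (pos (stack B X Y b) k d).2)
    = grid_of (stack B X Y) (line b' (pos (stack B X Y b') k d).1) (line k (pos (stack B X Y b)
      k d).2).
  by rewrite !grid_ofE cell_pos // E cell_pos.
apply/injectiveP => i i'; rewrite (lineE i) (lineE i') (lineE j) !grid_ofE.
set k := trit_of (j %/ 3); set c := trit_of (j %% 3).
set b := trit_of (i %/ 3); set r := trit_of (i %% 3).
set b' := trit_of (i' %/ 3); set r' := trit_of (i' %% 3) => E.
have P1 := pos_cell (vF b) k r c; have P2 := pos_cell (vF b') k r' c.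
rewrite -E in P2.
have R : rainbow (word_of (fun d => (pos (stack B X Y T0) k d).2))
  (word_of (fun d => (pos (stack B X Y T1) k d).2)) (word_of (fun d => (pos (stack B X Y T2) k
    d).2)) := H k.
have Eb : b = b'.
  apply: (rainbow_word_of (fun b d => (pos (stack B X Y b) k d).2) R (stack B X Y b (ord3 r)
    (line k c))).
  by rewrite /= P1 P2.
by move: P2; rewrite -Eb P1 => -[->].
Qed.

(** A completion is a pair of valid bands, the middle and the bottom one.
    Sorting these pairs by their column colourings, which in block [k] form a
    complement of [cols B k], factors the count. *)
Lemma card_completions B : valid_band B ->
  #|completions B| = completion_count (cols B T0) (cols B T1) (cols B T2).
Proof.
move=> vB.
pose P := [set XY : band * band | [&& valid_band XY.1, valid_band XY.2 &
   [forall k, rainbow (cols B k) (cols XY.1 k) (cols XY.2 k)]]].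
have -> : #|completions B| = #|P|.
  have inj : {in P &, injective (fun XY => grid_of (stack B XY.1 XY.2))}.
    move=> [X Y] [X' Y'] _ _ /= E; congr (_, _).
      by have := band_of_grid (stack B X Y) T1; rewrite E band_of_grid.
    by have := band_of_grid (stack B X Y) T2; rewrite E band_of_grid.
  rewrite -(card_in_imset inj); apply: eq_card => G; rewrite inE usubmx_band.
  apply/andP/imsetP => [[sG /eqP EB]|[[X Y]]].
    have EF : stack B (band_of G T1) (band_of G T2) =1 band_of G by case.
    have EG : G = grid_of (stack B (band_of G T1) (band_of G T2)).
      by rewrite -{1}(grid_of_band G); apply/matrixP => i j; rewrite mxE [RHS]mxE EF.
    move: (sG); rewrite sudoku_gridE => /andP[/forallP vb _].
    exists (band_of G T1, band_of G T2) => //=.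
    by rewrite inE /= !vb -sudoku_stack // -EG.
  rewrite inE /= => /and3P[vX vY R] ->; rewrite sudoku_stack // R; split=> //.
  by apply/eqP/matrixP => i j; rewrite band_of_grid.
pose v (XY : band * band) := valid_band XY.1 && valid_band XY.2.
pose m k (XY : band * band) := (cols XY.1 k, cols XY.2 k).
(* Both factors below are sums of indicators of pairs of bands, [E3] on the side
   of the formula and [Ek] on the side of the condition on block [k]. *)
have E3 p q s : #|bands_with p.1 q.1 s.1| * #|bands_with p.2 q.2 s.2| =
    \sum_(XY | v XY) (m T0 XY == p) * (m T1 XY == q) * (m T2 XY == s).
  rewrite -cardsX -sum1_card big_mkcond [RHS]big_mkcond.
  apply: eq_bigr => -[X Y] _; rewrite !inE /= /v /m /=.
  case: p q s => [a a'] [b b'] [c c']; rewrite !xpair_eqE /=.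
  case: (valid_band X); case: (valid_band Y); rewrite //= ?andbF //.
  by do 6!case: eqP => //=.
have Ek k XY : (rainbow (cols B k) (cols XY.1 k) (cols XY.2 k) : nat) =
    \sum_(p <- complements (cols B k)) (m k XY == p).
  rewrite -mem_complements -(count_uniq_mem _ (uniq_complements _)) -sum1_count big_mkcond /=.
  by apply: eq_bigr => p _; rewrite eq_sym; case: eqP.
transitivity (\sum_(XY | v XY) \sum_(p <- complements (cols B T0))
    \sum_(q <- complements (cols B T1))
    \sum_(s <- complements (cols B T2)) (m T0 XY == p) * (m T1 XY == q) * (m T2 XY == s)).
  rewrite -sum1_card big_mkcond [RHS]big_mkcond; apply: eq_bigr => -[X Y] _.
  rewrite inE /v /= andbA; case: (valid_band X && valid_band Y) => //=.
  have -> : [forall k, rainbow (cols B k) (cols X k) (cols Y k)] =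
    [&& rainbow (cols B T0) (cols X T0) (cols Y T0), rainbow (cols B T1) (cols X T1) (cols Y T1)
      & rainbow (cols B T2) (cols X T2) (cols Y T2)].
    by apply/forallP/and3P => [H|[? ? ?] []//]; split; apply: H.
  transitivity (nat_of_bool (rainbow (cols B T0) (cols X T0) (cols Y T0)) *
    (rainbow (cols B T1) (cols X T1) (cols Y T1)) * (rainbow (cols B T2) (cols X T2) (cols Y
      T2))).
    by do 3!case: rainbow.
  rewrite (Ek T0 (X, Y)) (Ek T1 (X, Y)) (Ek T2 (X, Y)).
  rewrite big_distrlr big_distrl; apply: eq_bigr => p _ /=.
  rewrite big_distrl; apply: eq_bigr => q _ /=.
  by rewrite big_distrr.
rewrite exchange_big big_seq [RHS]big_seq; apply: eq_bigr => p.
case: p => [m1 b1]; rewrite mem_complements => /rainbow_size[Sm1 Sb1].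
rewrite exchange_big big_seq [RHS]big_seq; apply: eq_bigr => q.
case: q => [m2 b2]; rewrite mem_complements => /rainbow_size[Sm2 Sb2].
rewrite exchange_big big_seq [RHS]big_seq; apply: eq_bigr => s.
case: s => [m3 b3]; rewrite mem_complements => /rainbow_size[Sm3 Sb3].
by rewrite -E3 !card_bands_with ?Sm1 ?Sm2 ?Sm3 ?Sb1 ?Sb2 ?Sb3 ?size_word_of.
Qed.

(** * Column partitions and isomorphism *)
Definition colour_partition (w : word) : {set {set 'I_9}} :=
  [set [set d : 'I_9 | nth T0 w d == k] | k : trit].

Definition balanced (w : word) :=
  [&& size w == 9, count_mem T0 w == 3, count_mem T1 w == 3 & count_mem T2 w == 3].

Lemma balanced_size w : balanced w -> size w = 9.
Proof. by case/and4P => /eqP. Qed.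

Lemma balanced_count w k : balanced w -> count_mem k w = 3.
Proof. by case/and4P => _ /eqP ? /eqP ? /eqP ?; case: k. Qed.

Lemma balancedP w : size w = 9 -> (forall k, count_mem k w = 3) -> balanced w.
Proof. by move=> Sw H; rewrite /balanced Sw !H. Qed.

Lemma card_class w k : size w = 9 -> #|[set d : 'I_9 | nth T0 w d == k]| = count_mem k w.
Proof.
move=> Sw; rewrite -{2}(word_of_nth Sw) count_map cardE size_filter enumT.
by apply: eq_count => d; rewrite /= inE.
Qed.

(** Nine distinct pairs of colours are all the pairs, so each colour occurs
    three times as a second component. *)
Lemma transversal_balanced r a : size r = 9 -> size a = 9 -> transversal r a -> balanced a.
Proof.
move=> Sr Sa U; apply: balancedP => // k.
pose L := [seq (x, y) | x <- [:: T0; T1; T2], y <- [:: T0; T1; T2]].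
have P : perm_eq (zip r a) L.
  apply: uniq_perm => //; have [|//|//] := uniq_min_size U (s2 := L).
    by move=> [x y] _; case: x y => [] [].
  by rewrite size_zip Sr Sa.
have -> : a = unzip2 (zip r a) by rewrite unzip2_zip ?Sr ?Sa.
by rewrite count_map (seq.permP P); case: k.
Qed.

Lemma cols_balanced X k : valid_band X -> balanced (cols X k).
Proof.
by move=> vX; apply: (@transversal_balanced (rows X k)); rewrite ?size_word_of ?transversal_band.
Qed.

Lemma column_set X k c : valid_band X ->
  [set X i (line k c) | i : 'I_3] = [set d : 'I_9 | nth T0 (cols X k) d == c].
Proof.
move=> vX; apply/setP => d; rewrite inE nth_word_of.
apply/imsetP/eqP => [[i _ ->]|<-]; first by rewrite -(trit_ofK i) pos_cell.
by exists (ord3 (pos X k d).1); rewrite ?cell_pos.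
Qed.

Lemma column_partition_cols X k : valid_band X ->
  column_partition X (ord3 k) = colour_partition (cols X k).
Proof.
move=> vX; apply/setP => S; apply/imsetP/imsetP => [[j]|[c _ ->]].
  rewrite inE => /line_fibre[c ->] ->; exists c => //; exact: column_set.
by exists (line k c); rewrite ?inE ?line_divn ?column_set.
Qed.

Lemma enum_ord3 : enum 'I_3 = [:: ord3 T0; ord3 T1; ord3 T2].
Proof. by apply: (inj_map val_inj); rewrite val_enum_ord. Qed.

Lemma band_msetE X : valid_band X ->
  band_mset X = seq_mset [:: colour_partition (cols X T0); colour_partition (cols X T1);
    colour_partition (cols X T2)].
Proof. by move=> vX; rewrite /band_mset /image_mem enum_ord3 -!column_partition_cols. Qed.

Lemma colour_partition_partitions333 w : balanced w -> colour_partition w \in partitions333.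
Proof.
move=> bw; have Sw := balanced_size bw.
have card3 k : #|[set d : 'I_9 | nth T0 w d == k]| = 3 by rewrite card_class ?balanced_count.
rewrite inE; apply/andP; split; last first.
  by apply/forallP => S; apply/implyP => /imsetP[k _ ->]; rewrite card3.
apply/and3P; split.
- rewrite eqEsubset subsetT; apply/subsetP => d _; apply/bigcupP.
  by exists [set d' : 'I_9 | nth T0 w d' == nth T0 w d]; rewrite ?inE //; apply: imset_f.
- apply/trivIsetP => _ _ /imsetP[k _ ->] /imsetP[k' _ ->] neq; rewrite disjoint_subset.
  apply/subsetP => d; rewrite !inE => /eqP E; apply: contraNneq neq => E'; by rewrite -E -E'.
- by apply/imsetP => -[k _ E]; have := card3 k; rewrite -E cards0.
Qed.

Lemma partitions333_colouring P : P \in partitions333 ->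
  exists2 w, balanced w & P = colour_partition w.
Proof.
rewrite inE => /andP[pP /forallP cP].
have cP3 A : A \in P -> #|A| = 3 by move=> AP; apply/eqP; have := cP A; rewrite AP.
have card_P : #|P| = 3.
  have := card_partition pP; rewrite cardsT card_ord (eq_bigr (fun=> 3)) ?sum_nat_const //.
  by case: #|P| => [|[|[|[|n]]]] //.
case/and3P: pP => /eqP covP /trivIsetP tP _.
have eP A : (A \in P) = (A \in enum (mem P)) by rewrite mem_enum.
have uP : uniq (enum (mem P)) := enum_uniq _.
move: card_P; rewrite cardE; case EP: (enum (mem P)) => [|A0 [|A1 [|A2 []]]] // _.
rewrite EP in uP; have {}eP A : (A \in P) = (A \in [:: A0; A1; A2]) by rewrite eP EP.
move: uP; rewrite /= !inE => /and3P[/norP[n01 n02] n12 _].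
have mP : [/\ A0 \in P, A1 \in P & A2 \in P] by rewrite !eP !inE !eqxx ?orbT.
case: mP => P0 P1 P2.
have d01 := tP _ _ P0 P1 n01; have d02 := tP _ _ P0 P2 n02; have d12 := tP _ _ P1 P2 n12.
have cov d : [|| d \in A0, d \in A1 | d \in A2].
  have: d \in cover P by rewrite covP inE.
  by case/bigcupP => A; rewrite eP !inE => /or3P[]/eqP -> ->; rewrite ?orbT.
(* Enumerate the three classes and colour each by its rank. *)
pose w d := if d \in A0 then T0 else if d \in A1 then T1 else T2.
pose S k := match k with T0 => A0 | T1 => A1 | T2 => A2 end.
have wS k : [set d : 'I_9 | nth T0 (word_of w) d == k] = S k.
  apply/setP => d; rewrite inE nth_word_of /w; have := cov d.
  case: (boolP (d \in A0)) => [d0 _|n0].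
    have /negbTE n1 : d \notin A1 by rewrite (disjointFr d01).
    have /negbTE n2 : d \notin A2 by rewrite (disjointFr d02).
    by case: k => /=; rewrite ?d0 ?n1 ?n2.
  case: (boolP (d \in A1)) => [d1 _|n1] /=.
    have /negbTE n2 : d \notin A2 by rewrite (disjointFr d12).
    by case: k => /=; rewrite ?(negbTE n0) ?d1 ?n2.
  by move=> d2; case: k => /=; rewrite ?(negbTE n0) ?(negbTE n1) ?d2.
exists (word_of w).
  apply: balancedP => [|k]; rewrite ?size_word_of // -card_class ?size_word_of // wS.
  by case: k => /=; apply: cP3.
apply/setP => A; rewrite eP; apply/idP/imsetP => [|[k _ ->]].
  by rewrite !inE => /or3P[]/eqP ->; [exists T0|exists T1|exists T2]; rewrite // wS.
by rewrite wS !inE; case: k; rewrite eqxx ?orbT.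
Qed.

Lemma colour_partition_map (pi : trit -> trit) w : injective pi -> size w = 9 ->
  colour_partition (map pi w) = colour_partition w.
Proof.
move=> pi_inj Sw; have [rho piK rhoK] := injF_bij pi_inj.
have E k : [set d : 'I_9 | nth T0 (map pi w) d == pi k] = [set d : 'I_9 | nth T0 w d == k].
  by apply/setP => d; rewrite !inE (nth_map T0) ?Sw // (inj_eq pi_inj).
apply/setP => S; apply/imsetP/imsetP => -[k _ ->].
  by exists (rho k) => //; rewrite -E rhoK.
by exists (pi k).
Qed.

Definition recoloured (w w' : word) := exists2 pi : trit -> trit, injective pi & w' = map pi w.

(** Two colourings with the same classes differ by a renaming of the colours:
    send the colour of a class in [w] to the colour of this class in [w']. *)
Lemma colour_partition_eq w w' : balanced w -> balanced w' ->
  colour_partition w = colour_partition w' -> recoloured w w'.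
Proof.
move=> bw bw' E; have Sw := balanced_size bw; have Sw' := balanced_size bw'.
have H k : {k' | [set d : 'I_9 | nth T0 w d == k] == [set d : 'I_9 | nth T0 w' d == k']}.
  apply: sigW; have: [set d : 'I_9 | nth T0 w d == k] \in colour_partition w' by rewrite -E
    imset_f.
  by case/imsetP => k' _ ->; exists k'.
exists (fun k => sval (H k)).
  move=> k k'; case: (H k) => x /= /eqP Ex; case: (H k') => y /= /eqP Ey xy.
  have /card_gt0P[d] : 0 < #|[set d : 'I_9 | nth T0 w d == k]| by rewrite card_class
    ?balanced_count.
  move=> dk; have dk' := dk; rewrite Ex xy -Ey in dk'.
  by move: dk dk'; rewrite !inE => /eqP -> /eqP.
apply: (@eq_from_nth _ T0); rewrite ?size_map ?Sw // => i; rewrite Sw' => Hi.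
rewrite (nth_map T0) ?Sw //; case: (H _) => x /= /eqP /setP/(_ (Ordinal Hi)).
by rewrite !inE /= eqxx => /esym/eqP.
Qed.

Lemma balanced_map (pi : trit -> trit) w : injective pi -> balanced w -> balanced (map pi w).
Proof.
move=> pi_inj bw; have [rho piK rhoK] := injF_bij pi_inj.
apply: balancedP => [|k]; first by rewrite size_map balanced_size.
rewrite count_map -(balanced_count (rho k) bw); apply: eq_count => x /=.
by rewrite -{1}(rhoK k) (inj_eq pi_inj).
Qed.

Lemma balanced_permute h w : perm_eq h (iota 0 9) -> balanced w -> balanced (permute h w).
Proof.
move=> hP bw; apply: balancedP => [|k]; first exact: size_permute.
by rewrite (seq.permP (perm_nth hP T0 (balanced_size bw))) balanced_count.
Qed.

Definition perm_list (s : {perm 'I_9}) : seq nat := [seq val (s i) | i <- enum 'I_9].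

Lemma perm_listP s : perm_eq (perm_list s) (iota 0 9).
Proof.
rewrite -val_enum_ord /perm_list map_comp; apply: perm_map; apply: uniq_perm.
- by rewrite map_inj_uniq ?enum_uniq //; apply: perm_inj.
- exact: enum_uniq.
move=> i; rewrite mem_enum; apply/mapP; exists (s^-1%g i); first by rewrite mem_enum.
by rewrite permKV.
Qed.

(** Lists which permute 0, ..., 8 and permutations of the digits are the same
    thing; the lists are what the computations below act with. *)
Lemma perm_list_onto h : perm_eq h (iota 0 9) -> exists s, perm_list s = h.
Proof.
move=> hP; have f_lt (i : 'I_9) : nth 0 h i < 9 by apply: (h_lt hP).
pose f i := Ordinal (f_lt i).
have f_inj : injective f.
  move=> i j /(congr1 val)/= /eqP; rewrite nth_uniq ?(size_h hP) // => [/eqP/val_inj //|].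
  by rewrite (perm_uniq hP) iota_uniq.
exists (perm f_inj); apply: (@eq_from_nth _ 0);
  rewrite size_map size_enum_ord ?(size_h hP) // => i Hi.
by rewrite (nth_map ord0) ?size_enum_ord // permE /= nth_enum_ord.
Qed.

(** A digit has after the move the colour which its preimage had before, hence
    the inverse. *)
Lemma partition_act_colour_partition s w : size w = 9 ->
  partition_act s (colour_partition w) = colour_partition (permute (perm_list s^-1) w).
Proof.
move=> Sw.
have E k : [set s x | x in [set d : 'I_9 | nth T0 w d == k]] =
           [set d : 'I_9 | nth T0 (permute (perm_list s^-1) w) d == k].
  apply/setP => d; rewrite inE (nth_permute (perm_listP _)) // (nth_map ord0) ?size_enum_ord //
    nth_ord_enum.
  apply/imsetP/idP => [[x]|H]; first by rewrite inE => H ->; rewrite permK.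
  by exists (s^-1%g d); rewrite ?inE ?permKV.
apply/setP => S; apply/imsetP/imsetP => [[A /imsetP[k _ ->] ->]|[k _ ->]].
  by exists k; rewrite ?E.
by exists [set d : 'I_9 | nth T0 w d == k]; rewrite ?E ?imset_f.
Qed.

(** Isomorphism of multisets, expressed on lists of partitions. *)
Definition isomorphic (s t : seq {set {set 'I_9}}) :=
  exists g : {perm 'I_9}, perm_eq [seq partition_act g P | P <- s] t.

Lemma mset_isoP s t : reflect (isomorphic s t) (mset_iso (seq_mset s) (seq_mset t)).
Proof.
have E g : (mset_act g (seq_mset s) == seq_mset t) = perm_eq [seq partition_act g P | P <- s] t.
  rewrite /mset_act; apply/eqP/idP => [/eq_seq_msetP|] H; last apply/eq_seq_msetP.
    by apply: perm_trans H; rewrite perm_sym; apply: perm_map; apply: perm_eq_seq_mset.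
  by apply: perm_trans H; apply: perm_map; apply: perm_eq_seq_mset.
by apply: (iffP existsP) => -[g]; [rewrite E | rewrite -E]; exists g.
Qed.

Lemma partition_act1 P : partition_act 1 P = P.
Proof.
rewrite /partition_act -[RHS]imset_id; apply: eq_imset => A.
by rewrite -[RHS]imset_id; apply: eq_imset => x; rewrite perm1.
Qed.

Lemma partition_actM g h P : partition_act h (partition_act g P) = partition_act (g * h)%g P.
Proof.
rewrite /partition_act -imset_comp; apply: eq_imset => A /=.
by rewrite -imset_comp; apply: eq_imset => x; rewrite permM.
Qed.

Lemma isomorphic_perm s t : perm_eq s t -> isomorphic s t.
Proof. by move=> st; exists 1%g; rewrite (eq_map partition_act1) map_id. Qed.

Lemma isomorphic_trans s t u : isomorphic s t -> isomorphic t u -> isomorphic s u.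
Proof.
move=> [g gP] [h hP]; exists (g * h)%g; apply: perm_trans hP.
rewrite -(eq_map (partition_actM g h)) map_comp; exact: perm_map.
Qed.

Lemma isomorphic_sym s t : isomorphic s t -> isomorphic t s.
Proof.
move=> [g gP]; exists g^-1%g; rewrite perm_sym.
have := perm_map (partition_act g^-1) gP; rewrite -map_comp.
rewrite (eq_map (partition_actM g g^-1)) mulgV (eq_map partition_act1) map_id; exact.
Qed.

Definition triple (a b c : word) := [:: colour_partition a; colour_partition b;
  colour_partition c].

Lemma isomorphic_permute h a b c : perm_eq h (iota 0 9) -> size a = 9 -> size b = 9 ->
  size c = 9 ->
  isomorphic (triple a b c) (triple (permute h a) (permute h b) (permute h c)).
Proof.
move=> hP Sa Sb Sc; have [s Es] := perm_list_onto hP.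
by exists s^-1%g; rewrite /= !partition_act_colour_partition // invgK Es.
Qed.

(** The six ways in which two lists of three elements can be permutations of
    each other, spelled out so that each is a product of exchanges. *)
Lemma perm_eq3 (T : eqType) (x y z x' y' z' : T) : perm_eq [:: x; y; z] [:: x'; y'; z'] ->
  [\/ x = x' /\ (y = y' /\ z = z' \/ y = z' /\ z = y'),
      x = y' /\ (y = x' /\ z = z' \/ y = z' /\ z = x') |
      x = z' /\ (y = x' /\ z = y' \/ y = y' /\ z = x')].
Proof.
have perm1 (u v : T) : perm_eq [:: u] [:: v] -> u = v.
  by move/perm_mem/(_ u); rewrite mem_head !inE => /esym/eqP.
have perm2 (u v u' v' : T) : perm_eq [:: u; v] [:: u'; v'] ->
    u = u' /\ v = v' \/ u = v' /\ v = u'.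
  move=> H; have: u \in [:: u'; v'] by rewrite -(perm_mem H) mem_head.
  rewrite !inE => /orP[]/eqP E; rewrite -E in H *; [left|right].
    by move: H; rewrite perm_cons => /perm1.
  have : perm_eq [:: u'; u] [:: u; u'] by apply/permPl/(perm_catC [:: u'] [:: u]).
  by move/(perm_trans H); rewrite perm_cons => /perm1.
move=> H; have: x \in [:: x'; y'; z'] by rewrite -(perm_mem H) mem_head.
rewrite !inE => /or3P[]/eqP E; rewrite -E in H *; [constructor 1|constructor 2|constructor 3].
- by move: H; rewrite perm_cons => /perm2.
- have : perm_eq [:: x'; x; z'] [:: x; x'; z']
    by apply/permPl/(perm_catCA [:: x'] [:: x] [:: z']).
  by move/(perm_trans H); rewrite perm_cons => /perm2.
- have : perm_eq [:: x'; y'; x] [:: x; x'; y'] by apply/permPl/(perm_catC [:: x'; y'] [:: x]).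
  by move/(perm_trans H); rewrite perm_cons => /perm2.
Qed.

Lemma completion_count_partitions a b c a' b' c' :
  balanced a -> balanced b -> balanced c -> balanced a' -> balanced b' -> balanced c' ->
  colour_partition a = colour_partition a' -> colour_partition b = colour_partition b' ->
    colour_partition c = colour_partition c' ->
  completion_count a b c = completion_count a' b' c'.
Proof.
move=> ba bb bc ba' bb' bc' /(colour_partition_eq ba ba')[pi pi_inj ->].
move=> /(colour_partition_eq bb bb')[rho rho_inj ->] /(colour_partition_eq bc bc')[tau tau_inj
  ->].
rewrite completion_count_recolour1 // completion_count_swap12 [RHS]completion_count_swap12
  completion_count_recolour1 //.
rewrite completion_count_swap12 completion_count_swap23 completion_count_swap12
  [RHS]completion_count_swap12 [RHS]completion_count_swap23 [RHS]completion_count_swap12.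
by rewrite completion_count_recolour1.
Qed.

(** One half of the comparison of the classifications: isomorphic multisets of
    column partitions admit equally many completions. *)
Lemma completion_count_isomorphic a b c a' b' c' :
  balanced a -> balanced b -> balanced c -> balanced a' -> balanced b' -> balanced c' ->
  isomorphic (triple a b c) (triple a' b' c') ->
    completion_count a b c = completion_count a' b' c'.
Proof.
move=> ba bb bc ba' bb' bc' [g]; have hP := perm_listP g^-1.
rewrite /= !partition_act_colour_partition ?balanced_size //.
have := balanced_permute hP ba; have := balanced_permute hP bb; have := balanced_permute hP bc.
rewrite -(completion_count_permute hP (balanced_size ba) (balanced_size bb) (balanced_size bc)).
move: (permute _ a) (permute _ b) (permute _ c) => {ba bb bc}a {}b {}c bc bb ba.
case/perm_eq3 => -[Ea [[Eb Ec]|[Eb Ec]]].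
- exact: completion_count_partitions.
- by rewrite completion_count_swap23; apply: completion_count_partitions.
- by rewrite completion_count_swap12; apply: completion_count_partitions.
- by rewrite completion_count_swap23 completion_count_swap12; apply: completion_count_partitions.
- by rewrite completion_count_swap12 completion_count_swap23; apply: completion_count_partitions.
- by rewrite completion_count_swap23 completion_count_swap12 completion_count_swap23;
  apply: completion_count_partitions.
Qed.

(** * Residues modulo 5, 7 and 11 *)

(** The counts of completions, of the order of [10 ^ 7] after division by 288,
    are only needed up to equality, and the 44 counts at the seeds are distinct
    modulo [385 = 5 * 7 * 11].  Three small residues make every addition and
    multiplication a table lookup. *)
Inductive z5 := A0 | A1 | A2 | A3 | A4.
Inductive z7 := B0 | B1 | B2 | B3 | B4 | B5 | B6.
Inductive z11 := C0 | C1 | C2 | C3 | C4 | C5 | C6 | C7 | C8 | C9 | C10.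

Definition nat5 x := match x with A0 => 0 | A1 => 1 | A2 => 2 | A3 => 3 | A4 => 4 end.
Definition nat7 x :=
  match x with B0 => 0 | B1 => 1 | B2 => 2 | B3 => 3 | B4 => 4 | B5 => 5 | B6 => 6 end.
Definition nat11 x :=
  match x with
  | C0 => 0 | C1 => 1 | C2 => 2 | C3 => 3 | C4 => 4 | C5 => 5 | C6 => 6
  | C7 => 7 | C8 => 8 | C9 => 9 | C10 => 10
  end.

Fixpoint mod5 n :=
  match n with 0 => A0 | 1 => A1 | 2 => A2 | 3 => A3 | 4 => A4 | m.+4.+1 => mod5 m end.
Fixpoint mod7 n :=
  match n with
  | 0 => B0 | 1 => B1 | 2 => B2 | 3 => B3 | 4 => B4 | 5 => B5 | 6 => B6
  | m.+4.+3 => mod7 m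
  end.
Fixpoint mod11 n :=
  match n with
  | 0 => C0 | 1 => C1 | 2 => C2 | 3 => C3 | 4 => C4 | 5 => C5 | 6 => C6
  | 7 => C7 | 8 => C8 | 9 => C9 | 10 => C10 | m.+4.+4.+3 => mod11 m
  end.

(** Replaces a binary operation by the table of its values, so that it
    evaluates by two case distinctions. *)
Ltac tabulate f :=
  let t := constr:(fun x y => ltac:(
    let z := fresh in pose (z := f x y); destruct x, y;
    let v := eval vm_compute in z in exact v)) in
  let t' := eval cbv zeta in t in exact t'.

Definition add5 : z5 -> z5 -> z5 :=
  ltac:(tabulate (fun x y => mod5 (nat5 x + nat5 y))).
Definition mul5 : z5 -> z5 -> z5 :=
  ltac:(tabulate (fun x y => mod5 (nat5 x * nat5 y))).
Definition add7 : z7 -> z7 -> z7 :=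
  ltac:(tabulate (fun x y => mod7 (nat7 x + nat7 y))).
Definition mul7 : z7 -> z7 -> z7 :=
  ltac:(tabulate (fun x y => mod7 (nat7 x * nat7 y))).
Definition add11 : z11 -> z11 -> z11 :=
  ltac:(tabulate (fun x y => mod11 (nat11 x + nat11 y))).
Definition mul11 : z11 -> z11 -> z11 :=
  ltac:(tabulate (fun x y => mod11 (nat11 x * nat11 y))).

Section Residues.
Variables (T : Type) (p : nat) (to_nat : T -> nat) (of_nat : nat -> T) (add mul : T -> T -> T).
Hypothesis to_natK : cancel to_nat of_nat.
Hypothesis of_natK : forall n, to_nat (of_nat n) = n %% p.
Hypothesis addE : forall x y, add x y = of_nat (to_nat x + to_nat y).
Hypothesis mulE : forall x y, mul x y = of_nat (to_nat x * to_nat y).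

(** The three moduli share this argument; on representatives it is modular
    arithmetic of natural numbers. *)
Lemma residue_fma a b c :
  add (of_nat c) (mul (of_nat a) (of_nat b)) = of_nat (c + a * b).
Proof.
by apply: (can_inj to_natK); rewrite addE mulE !of_natK modnMml modnMmr modnDmr modnDml.
Qed.
End Residues.

Lemma mod5K n : nat5 (mod5 n) = n %% 5.
Proof.
elim/ltn_ind: n => -[|[|[|[|[|n]]]]] IH //.
by rewrite [mod5 _]/= IH; [apply/esym/(modnDl n 5) | apply: (leq_addl 4 n)].
Qed.

Lemma mod7K n : nat7 (mod7 n) = n %% 7.
Proof.
elim/ltn_ind: n => -[|[|[|[|[|[|[|n]]]]]]] IH //.
by rewrite [mod7 _]/= IH; [apply/esym/(modnDl n 7) | apply: (leq_addl 6 n)].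
Qed.

Lemma mod11K n : nat11 (mod11 n) = n %% 11.
Proof.
elim/ltn_ind: n => -[|[|[|[|[|[|[|[|[|[|[|n]]]]]]]]]]] IH //.
by rewrite [mod11 _]/= IH; [apply/esym/(modnDl n 11) | apply: (leq_addl 10 n)].
Qed.

Lemma fma5 a b c : add5 (mod5 c) (mul5 (mod5 a) (mod5 b)) = mod5 (c + a * b).
Proof. by apply: residue_fma mod5K _ _ a b c; [case|case; case..]. Qed.
Lemma fma7 a b c : add7 (mod7 c) (mul7 (mod7 a) (mod7 b)) = mod7 (c + a * b).
Proof. by apply: residue_fma mod7K _ _ a b c; [case|case; case..]. Qed.
Lemma fma11 a b c : add11 (mod11 c) (mul11 (mod11 a) (mod11 b)) = mod11 (c + a * b).
Proof. by apply: residue_fma mod11K _ _ a b c; [case|case; case..]. Qed.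

Inductive residue := Residue of z5 & z7 & z11.

(** Identities in their first argument, but which examine it before passing it
    on.  A residue built by [strict_residue] therefore holds values, and a long
    sum does not pile up as an unevaluated expression. *)
Definition force5 A (x : z5) (k : z5 -> A) : A :=
  match x with A0 => k A0 | A1 => k A1 | A2 => k A2 | A3 => k A3 | A4 => k A4 end.
Definition force7 A (x : z7) (k : z7 -> A) : A :=
  match x with
  | B0 => k B0 | B1 => k B1 | B2 => k B2 | B3 => k B3 | B4 => k B4 | B5 => k B5
  | B6 => k B6
  end.
Definition force11 A (x : z11) (k : z11 -> A) : A :=
  match x with
  | C0 => k C0 | C1 => k C1 | C2 => k C2 | C3 => k C3 | C4 => k C4 | C5 => k C5
  | C6 => k C6 | C7 => k C7 | C8 => k C8 | C9 => k C9 | C10 => k C10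
  end.
Definition strict_residue a b c : residue :=
  force5 a (fun a => force7 b (fun b => force11 c (fun c => Residue a b c))).

Lemma strict_residueE a b c : strict_residue a b c = Residue a b c.
Proof. by case: a; case: b; case: c. Qed.

Definition residue_of n := strict_residue (mod5 n) (mod7 n) (mod11 n).

Definition fma (x y acc : residue) : residue :=
  match x, y, acc with
  | Residue a b c, Residue a' b' c', Residue a0 b0 c0 =>
      strict_residue (add5 a0 (mul5 a a')) (add7 b0 (mul7 b b')) (add11 c0 (mul11 c c'))
  end.

Lemma fmaE a b c :
  fma (residue_of a) (residue_of b) (residue_of c) = residue_of (c + a * b).
Proof. by rewrite /residue_of !strict_residueE /fma strict_residueE fma5 fma7 fma11. Qed.

Definition residue_nats (x : residue) : nat * nat * nat :=
  let: Residue a b c := x in (nat5 a, nat7 b, nat11 c).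

(** * Tries indexed by words *)

(** Exchanging two adjacent letters in all the keys of a trie only rearranges
    its subtries at one level ([lookup_swap_levels]), and sums over the
    complements of a word become traversals of two tries ([walkE]).  This is
    why functions on colourings are stored this way. *)
Inductive trie (V : Type) : Type :=
  Empty | Leaf of V | Node of trie V & trie V & trie V.
Arguments Empty {V}.
Arguments Leaf {V}.
Arguments Node {V}.

Fixpoint swap_at (T : Type) (i : nat) (w : seq T) : seq T :=
  match i, w with
  | 0, x :: y :: w' => y :: x :: w'
  | i'.+1, x :: w' => x :: swap_at i' w'
  | _, _ => w
  end.

Section Trie.
Variable V : Type.
Implicit Types t u : trie V.

Definition child t x :=
  if t is Node a b c then match x with T0 => a | T1 => b | T2 => c end else Empty.

Fixpoint lookup t (w : word) : option V :=
  match w with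
  | [::] => if t is Leaf v then Some v else None
  | x :: w' => lookup (child t x) w'
  end.

Definition set_child t x u :=
  match x with
  | T0 => Node u (child t T1) (child t T2)
  | T1 => Node (child t T0) u (child t T2)
  | T2 => Node (child t T0) (child t T1) u
  end.

Fixpoint insert (w : word) v t : trie V :=
  if w is x :: w' then set_child t x (insert w' v (child t x)) else Leaf v.

(** A function on partitions is stored at all six colourings of a partition. *)
Definition insert_recolourings (w : word) v t :=
  foldl (fun t p => insert (map (recolour p) w) v t) t recolourings.

Fixpoint swap_levels (i : nat) t : trie V :=
  match t, i with
  | Node a b c, i'.+1 =>
      Node (swap_levels i' a) (swap_levels i' b) (swap_levels i' c)
  | Node a b c, 0 =>
      Node (Node (child a T0) (child b T0) (child c T0))
           (Node (child a T1) (child b T1) (child c T1))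
           (Node (child a T2) (child b T2) (child c T2))
  | _, _ => t
  end.

(** Whether a leaf is present at every word of length [n] with [i], [j], [k]
    letters of each colour. *)
Fixpoint full t (i j k n : nat) : bool :=
  match n with
  | 0 => if t is Leaf _ then true else false
  | n'.+1 => [&& if i is i'.+1 then full (child t T0) i' j k n' else true,
                 if j is j'.+1 then full (child t T1) i j' k n' else true
               & if k is k'.+1 then full (child t T2) i j k' n' else true]
  end.

Lemma lookup_insert w w' v t : size w = size w' ->
  lookup (insert w v t) w' = if w == w' then Some v else lookup t w'.
Proof.
elim: w w' t => [|x w IH] [|y w'] t //= [Sw].
rewrite eqseq_cons /=; case: eqP => [<-|neq] /=.
  by rewrite -IH //; case: x.
by case: x y neq => [] [].
Qed.

Lemma lookup_Empty w : lookup Empty w = None.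
Proof. by elim: w. Qed.

Lemma lookup_swap_levels i t w : i.+1 < size w ->
  lookup (swap_levels i t) w = lookup t (swap_at i w).
Proof.
elim: i t w => [|i IH] t [|x [|y w]] // Hi.
  case: t => [|v|a b c]; rewrite /= ?lookup_Empty //.
  by case: x {Hi}; case: y.
case: t => [|v|a b c]; try by rewrite !lookup_Empty.
  by rewrite /= !lookup_Empty.
by case: x {Hi} (Hi : i.+1 < size (y :: w)) => Hi; apply: (IH _ (y :: w)).
Qed.

Lemma full_lookup t i j k n w : full t i j k n -> size w = n ->
  count_mem T0 w = i -> count_mem T1 w = j -> count_mem T2 w = k -> lookup t w <> None.
Proof.
elim: n t i j k w => [|n IH] t i j k [|x w] //=; first by case: t.
move=> /and3P[F0 F1 F2] [Sw]; case: x => /=; rewrite !add0n add1n.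
- by move=> Ei Ej Ek; rewrite -Ei in F0; apply: IH F0 _ _ _ _.
- by move=> Ei Ej Ek; rewrite -Ej in F1; apply: IH F1 _ _ _ _.
- by move=> Ei Ej Ek; rewrite -Ek in F2; apply: IH F2 _ _ _ _.
Qed.

(** The invariant by which tables are proved correct while they grow. *)
Definition entries_in (Q : word -> V -> Prop) t :=
  forall w v, size w = 9 -> lookup t w = Some v -> Q w v.

Lemma entries_insert_recolourings (Q : word -> V -> Prop) w v t : size w = 9 ->
  entries_in Q t -> (forall p, p \in recolourings -> Q (map (recolour p) w) v) ->
  entries_in Q (insert_recolourings w v t).
Proof.
move=> Sw; rewrite /insert_recolourings; elim: recolourings t => [|p s IH] t //= Qt Qp.
apply: IH => [w' v' Sw'|q qs]; last by apply: Qp; rewrite inE qs orbT.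
rewrite lookup_insert ?size_map ?Sw //; case: eqP => [<- [<-]|_]; last exact: Qt.
by apply: Qp; rewrite mem_head.
Qed.
End Trie.

Section Walk.
Variables (V K : Type) (leaf : V -> V -> K -> K).
(** The letter [x] of [c] forces the letters of the two complementary words to
    be the other two colours, so the traversal branches twice at each level.
    Threading the accumulator avoids building the list of complements. *)
Fixpoint walk (c : word) (t u : trie V) (acc : K) : K :=
  match t with
  | Empty => acc
  | Leaf v =>
      match u with
      | Leaf v' => if c is [::] then leaf v v' acc else acc
      | _ => acc
      end
  | Node a0 a1 a2 =>
      match u with
      | Node b0 b1 b2 =>
         match c with
         | [::] => acc
         | T0 :: c' => walk c' a1 b2 (walk c' a2 b1 acc)
         | T1 :: c' => walk c' a0 b2 (walk c' a2 b0 acc)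
         | T2 :: c' => walk c' a0 b1 (walk c' a1 b0 acc)
         end
      | _ => acc
      end
  end.

Definition at_leaf (t u : trie V) (p : word * word) (acc : K) :=
  match lookup t p.1, lookup u p.2 with
  | Some v, Some v' => leaf v v' acc
  | _, _ => acc
  end.

Lemma walkE c t u acc : walk c t u acc = foldr (at_leaf t u) acc (complements c).
Proof.
have skip t' u' (s : seq (word * word)) acc' :
    {in s, forall p, lookup t' p.1 = None \/ lookup u' p.2 = None} ->
    foldr (at_leaf t' u') acc' s = acc'.
  elim: s => //= p s IHs H; rewrite IHs => [|q qs]; last by apply: H; rewrite inE qs orbT.
  by rewrite /at_leaf; case: (H p (mem_head _ _)) => -> //; case: (lookup t' p.1).
elim: c t u acc => [|x c IH] t u acc; first by case: t => [|v|? ? ?]; case: u.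
have skip1 t' u' :
    (forall w, 0 < size w -> lookup t' w = None) \/
    (forall w, 0 < size w -> lookup u' w = None) ->
    acc = foldr (at_leaf t' u') acc (complements (x :: c)).
  move=> H; rewrite skip // => -[m b]; rewrite mem_complements => /rainbow_size[Sm Sb].
  by case: H => H; [left|right]; apply: H; rewrite ?Sm ?Sb.
have nE w : lookup (@Empty V) w = None := lookup_Empty _ w.
have nL v w : 0 < size w -> lookup (Leaf v) w = None by case: w => //= y w _;
  rewrite lookup_Empty.
case: t => [|v|a0 a1 a2]; [by apply: skip1; left => w _|by case: u => *; apply: skip1;
  left => w Sw; apply: nL|].
case: u => [|v|b0 b1 b2]; [by apply: skip1; right => w _|by apply: skip1; right => w Sw;
  apply: nL|].
by case: x {skip1}; rewrite /= cats0 foldr_cat !foldr_map !IH.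
Qed.
End Walk.

(** * Row fillings over the standard partition *)
Definition std : word := [:: T0; T0; T0; T1; T1; T1; T2; T2; T2].

Fixpoint balanced_words (i j k n : nat) : seq word :=
  if n is n'.+1 then
    (if i is i'.+1 then map (cons T0) (balanced_words i' j k n') else [::]) ++
    (if j is j'.+1 then map (cons T1) (balanced_words i j' k n') else [::]) ++
    (if k is k'.+1 then map (cons T2) (balanced_words i j k' n') else [::])
  else [:: [::]].

(** The first colours to appear are [T0] and then [T1]: among the six colourings
    of a partition exactly one is [canonical]. *)
Fixpoint t1_first (w : word) : bool :=
  match w with T0 :: w' => t1_first w' | T1 :: _ => true | _ => false end.
Definition canonical (w : word) : bool :=
  if w is T0 :: w' then t1_first w' else false.
Definition partition_words := filter canonical (balanced_words 3 3 3 9).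

Definition trit_eqb (x y : trit) : bool :=
  match x, y with T0, T0 | T1, T1 | T2, T2 => true | _, _ => false end.
Lemma trit_eqbE x y : trit_eqb x y = (x == y). Proof. by case: x y => [] []. Qed.

Definition third (x y : trit) : trit :=
  match x, y with
  | T0, T1 | T1, T0 => T2
  | T0, T2 | T2, T0 => T1
  | T1, T2 | T2, T1 => T0
  | _, _ => x
  end.

(** For every column colour, the row colours which no digit of that column has
    received yet. *)
Record availability := Availability { for_T0 : seq trit; for_T1 : seq trit; for_T2 : seq trit }.
Definition available (A : availability) (y : trit) :=
  match y with T0 => for_T0 A | T1 => for_T1 A | T2 => for_T2 A end.
Definition drop_trit (x : trit) (s : seq trit) := filter (fun z => ~~ trit_eqb x z) s.
Definition use (A : availability) (x y : trit) : availability :=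
  let: Availability a b c := A in
  match y with
  | T0 => Availability (drop_trit x a) b c
  | T1 => Availability a (drop_trit x b) c
  | T2 => Availability a b (drop_trit x c)
  end.
Definition trits := [:: T0; T1; T2].
Definition unrestricted := Availability trits trits trits.

(** The row colourings of a block with column colouring [c]: going through the
    digits, every column must use each row once. *)
Fixpoint transversals (A : availability) (c : word) : seq word :=
  if c is y :: c' then
    flatten [seq map (cons x) (transversals (use A x y) c') | x <- available A y]
  else [:: [::]].

(** Follows the branches of [transversals] and of the trie simultaneously, hence
    sums the values stored at transversals without listing them. *)
Fixpoint count_transversals (A : availability) (c : word) (t : trie nat) : nat :=
  match t, c with
  | Empty, _ => 0
  | Leaf n, [::] => n
  | _, y :: c' =>
      foldr (fun x n => count_transversals (use A x y) c' (child t x) + n) 0 (available A y)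
  | _, _ => 0
  end.

Lemma available_use A x y z : available (use A x y) z =
  if z == y then drop_trit x (available A z) else available A z.
Proof. by case: A => a b c; case: y z => [] []. Qed.

Lemma mem_drop_trit x z s : (z \in drop_trit x s) = (z != x) && (z \in s).
Proof. by rewrite mem_filter trit_eqbE eq_sym. Qed.

Lemma mem_transversals A c q : (q \in transversals A c) =
  [&& size q == size c, transversal q c & all (fun p => p.1 \in available A p.2) (zip q c)].
Proof.
elim: c A q => [|y c IH] A q; first by rewrite /= inE; case: q.
apply/flatten_mapP/idP => [[x xA /mapP[q' q'T ->]]|].
  move: q'T; rewrite IH => /and3P[/eqP Sq Tq Aq].
  rewrite /= Sq eqxx xA /transversal /= [uniq _]Tq andbT /=.
  have Hq p : p \in zip q' c -> p.1 \in available A p.2 /\ p != (x, y).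
    move=> pq; have := allP Aq p pq; rewrite available_use.
    case: p {pq} => u v /=; rewrite xpair_eqE; case: eqP => [->|_]; last by rewrite andbF.
    by rewrite mem_drop_trit andbT => /andP[].
  apply/andP; split; first by apply/negP => /Hq[_]; rewrite eqxx.
  by apply/allP => p /Hq[].
case: q => [//|x q] /and3P[/= Sq Tq /andP[xA Aq]].
exists x => //; apply/mapP; exists q => //.
rewrite IH; move: Tq; rewrite /transversal /= => /andP[xq ->].
rewrite -eqSS Sq /=; apply/allP => -[u v] uv; have := allP Aq _ uv; rewrite /= available_use.
case: eqP => [E|//] uA; rewrite mem_drop_trit uA andbT.
by apply: contraNneq xq => E'; rewrite -E' -E.
Qed.

Lemma mem_unrestricted c q : (q \in transversals unrestricted c) =
  (size q == size c) && transversal q c.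
Proof.
rewrite mem_transversals; case: (_ == _) => //=; case: (transversal q c) => //=.
by apply/allP => -[x y] _; case: x y => [] [].
Qed.

Lemma uniq_transversals A c : (forall y, uniq (available A y)) -> uniq (transversals A c).
Proof.
elim: c A => [//|y c IH] A UA /=.
have UA' x z : uniq (available (use A x y) z).
  by rewrite available_use; case: eqP => // _; apply: filter_uniq.
have := UA y; elim: (available A y) => //= x s IHs /andP[xs Us].
rewrite cat_uniq map_inj_uniq ?IH // => [|? ? []//]; rewrite IHs // andbT.
apply/hasPn => w /flatten_mapP[x' x's /mapP[w' _ ->]]; apply/mapP => -[w'' _ [E _]].
by rewrite -E x's in xs.
Qed.

Lemma uniq_unrestricted c : uniq (transversals unrestricted c).
Proof. by apply: uniq_transversals => -[]. Qed.

Lemma count_transversalsE A c t :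
  count_transversals A c t = \sum_(q <- transversals A c) odflt 0 (lookup t q).
Proof.
elim: c A t => [|y c IH] A t; first by rewrite big_seq1; case: t.
have -> : count_transversals A (y :: c) t =
    foldr (fun x n => count_transversals (use A x y) c (child t x) + n) 0 (available A y).
  by case: t => //=; elim: (available A y) => //= x s <-; rewrite IH big1 // => q _;
    rewrite lookup_Empty.
rewrite [transversals _ _]/=; elim: (available A y) => [|x s IHs] /=; first by rewrite big_nil.
by rewrite big_cat big_map IHs IH.
Qed.

Fixpoint nowhere_equal (r q : word) : bool :=
  match r, q with
  | x :: r', y :: q' => if trit_eqb x y then false else nowhere_equal r' q'
  | _, _ => true
  end.
Fixpoint third_word (r q : word) : word :=
  match r, q with
  | x :: r', y :: q' => third x y :: third_word r' q'
  | _, _ => [::]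
  end.

Lemma rainbow_third r q s : size r = size s ->
  rainbow r q s = nowhere_equal r s && (q == third_word r s).
Proof.
elim: r q s => [|x r IH] [|y q] [|z s] //=; first by rewrite andbF.
move=> [Sr]; rewrite IH // eqseq_cons.
by case: x y z => [] [] []; rewrite //= ?andbF.
Qed.

Lemma size_third_word r s : size r = size s -> size (third_word r s) = size r.
Proof. by elim: r s => [|x r IH] [|z s] //= [/IH ->]. Qed.

(** Digits 0, 1 and 2 form a column of [std], so they lie in different rows.
    Renaming the rows puts them in the rows [T0], [T1], [T2] in this order. *)
Definition normal (s : word) : bool :=
  match s with T0 :: T1 :: T2 :: _ => true | _ => false end.

Lemma normalE s : normal s = (take 3 s == [:: T0; T1; T2]).
Proof. by case: s => [|[] [|[] [|[] s]]] //=; rewrite take0. Qed.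

Definition normal_colourings : seq word :=
  [seq s <- transversals unrestricted std | normal s].
(** For a first block with column partition [x] and a third one with column
    partition [std], the row colourings of the second block that complete a
    choice of row colourings of these two, the third one being normal.  They
    come with multiplicity: [second_colouring_counts] is the tally. *)
Definition second_colourings (x : word) : seq word :=
  let tx := transversals unrestricted x in
  flatten [seq [seq third_word r s | r <- tx & nowhere_equal r s] | s <- normal_colourings].
Definition second_colouring_counts (x : word) : trie nat :=
  foldl (fun t q => insert q (odflt 0 (lookup t q)).+1 t) Empty (second_colourings x).

Lemma recolour_inj p : p \in recolourings -> injective (recolour p).
Proof. by case: p => [[a b] c]; rewrite mem_recolourings; case: a b c => [] [] [] // _ [] []. Qed.

(** The factor 6 counts the renamings of the rows.  They permute the row
    fillings freely, and each orbit has one filling which is normal on the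
    third block; the first and third row colourings then determine the second
    one. *)
Lemma row_fillings_std x y : size x = 9 -> size y = 9 ->
  row_fillings x y std = 6 * count (fun q => transversal q y) (second_colourings x).
Proof.
move=> Sx Sy.
(* Split the row fillings by the rows of the digits 0, 1 and 2 in the third
   block; the six parts correspond to each other by renaming the rows. *)
pose ok (t : word * word * word) := [&& transversal t.1.1 x,
  transversal t.1.2 y & transversal t.2 std].
pose starts (p : trit * trit * trit) (t : word * word * word) :=
  take 3 t.2 == [:: p.1.1; p.1.2; p.2].
have split_ok : row_fillings x y std =
  \sum_(p <- recolourings) count (predI ok (starts p)) (rainbows 9).
  have -> : row_fillings x y std = count ok (rainbows 9) by rewrite row_fillings.unlock.
  rewrite -sum1_count big_mkcond.
  rewrite (eq_bigr (fun p => \sum_(t <- rainbows 9) (predI ok (starts p) t : nat))); last first.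
    by move=> p _; rewrite -sum1_count big_mkcond; apply: eq_bigr => t _; case: (predI _ _ t).
  rewrite exchange_big; apply: eq_big_seq => -[[r q] s]; rewrite mem_rainbows.
  move=> /andP[/eqP Sr /rainbow_size[_ Ss]]; rewrite Sr in Ss.
  rewrite (eq_bigr (fun p => (ok (r, q, s) && starts p (r, q, s) : nat))) //.
  case: ifP => [/and3P[/= _ _ Ts]|_]; last by rewrite big1.
  rewrite /starts /=.
  case: s Ss Ts => [|s0 [|s1 [|s2 s]]] // _ Ts; rewrite [take _ _]/= take0.
  have Ep p : ([:: s0; s1; s2] == [:: p.1.1; p.1.2; p.2]) = (p == (s0, s1, s2)).
    by case: p => [[a b] c] /=; apply/eqP/eqP => [[-> -> ->]|[-> -> ->]].
  rewrite (eq_bigr _ (fun p _ => congr1 nat_of_bool (Ep p))).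
  have U : (s0, s1, s2) \in recolourings.
    rewrite mem_recolourings; move: Ts;
      rewrite /transversal /= !inE !xpair_eqE !eqxx !andbT !negb_or.
    by rewrite /distinct3 => /and4P[/and3P[-> -> _] /andP[-> _]].
  transitivity (count_mem (s0, s1, s2) recolourings); first by rewrite count_uniq_mem // U.
  by rewrite -sum1_count big_mkcond; apply: eq_bigr => p _ /=; case: (_ == _).
have same p : p \in recolourings ->
  count (predI ok (starts p)) (rainbows 9) = count (predI ok (starts (T0, T1, T2))) (rainbows 9).
  move=> pR; have pi_inj := recolour_inj pR; set pi := recolour p in pi_inj.
  have Hp : perm_eq (map (fun t => (map pi t.1.1, map pi t.1.2,
    map pi t.2)) (rainbows 9)) (rainbows 9).
    apply: perm_map_stable; first exact: uniq_rainbows.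
      by move=> [[r q] s]; rewrite !mem_rainbows size_map rainbow_recolour.
    by move=> [[r q] s] [[r' q'] s'] _ _ /= [/(inj_map pi_inj) -> /(inj_map pi_inj) ->
      /(inj_map pi_inj) ->].
  rewrite -(seq.permP Hp) count_map; apply: eq_count => -[[r q] s] /=.
  rewrite /ok /starts /= !transversal_recolour_rows // -map_take.
  have -> : [:: p.1.1; p.1.2; p.2] = map pi [:: T0; T1; T2] by [].
  by rewrite (inj_eq (inj_map pi_inj)).
rewrite split_ok (eq_big_seq _ same) big_const_seq iter_addn_0 mulnC; congr (_ * _).
pose E := [seq ((r, third_word r s), s) | s <- normal_colourings,
  r <- [seq r <- transversals unrestricted x | nowhere_equal r s]].
have -> : second_colourings x = [seq t.1.2 | t <- E].
  rewrite /E /second_colourings /allpairs_dep map_flatten -map_comp; congr flatten.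
  by apply: eq_map => s /=; rewrite -map_comp.
(* [E] lists the fillings that are normal on the third block, before the
   condition on the second block is imposed. *)
have PE : perm_eq E [seq t <- rainbows 9 | [&& transversal t.1.1 x,
  transversal t.2 std & starts (T0, T1, T2) t]].
  apply: uniq_perm; last 1 first.
  - move=> [[r q] s]; rewrite mem_filter mem_rainbows.
    apply/allpairsPdep/idP => [[s' [r' [Hs Hr [-> -> ->]]]]|].
      move: Hs Hr; rewrite !mem_filter !mem_unrestricted Sx.
      move=> /and3P[st /eqP Ss Ts] /and3P[D /eqP Sr Tr].
      rewrite /= Tr Ts Sr rainbow_third ?Sr ?Ss // D !eqxx andbT /starts /=.
      by rewrite -normalE st.
    move=> /andP[/and3P[/= Tr Ts st] /andP[/eqP Sr /[dup]/rainbow_size[_ Ss]]].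
    rewrite rainbow_third ?Ss // => /andP[D /eqP Eq].
    exists s, r; rewrite !mem_filter !mem_unrestricted D Sx Ss Sr eqxx Tr Ts Eq; split=> //.
    by rewrite !andbT normalE.
  - apply: allpairs_uniq_dep => [|s _|]; rewrite ?filter_uniq ?uniq_unrestricted //.
    by move=> [s r] [s' r'] _ _ /= [-> _ ->].
  - by rewrite filter_uniq ?uniq_rainbows.
rewrite count_map (seq.permP PE) count_filter; apply: eq_count => -[[r q] s].
by rewrite /= /ok /=; case: (transversal r x); case: (transversal q y);
  case: (transversal s std); case: (starts _ _).
Qed.

Lemma balanced_words_size i j k n w : w \in balanced_words i j k n -> size w = n.
Proof.
elim: n i j k w => [|n IH] i j k w /=; first by rewrite inE => /eqP ->.
by rewrite !mem_cat => /or3P[]; [case: i|case: j|case: k] => // m /mapP[w' /IH Sw ->] /=;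
  rewrite Sw.
Qed.

Lemma partition_words_size w : w \in partition_words -> size w = 9.
Proof. by rewrite mem_filter => /andP[_ /balanced_words_size]. Qed.

(** Columns that do not consist of three digits each admit no filling. *)
Lemma row_fillings_unbalanced1 a b c : size a = 9 -> ~~ balanced a -> row_fillings a b c = 0.
Proof.
move=> Sa; apply: contraNeq; rewrite row_fillings.unlock -lt0n -has_count => /hasP[[[r q] s]].
rewrite mem_rainbows => /andP[/eqP Sr _] /and3P[Tr _ _]; exact: transversal_balanced Sr Sa Tr.
Qed.

Lemma row_fillings_unbalanced2 a b c : size b = 9 -> ~~ balanced b -> row_fillings a b c = 0.
Proof. by rewrite row_fillings_swap12; apply: row_fillings_unbalanced1. Qed.

Lemma row_fillings_unbalanced3 a b c : size c = 9 -> ~~ balanced c -> row_fillings a b c = 0.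
Proof. by rewrite row_fillings_swap23; apply: row_fillings_unbalanced2. Qed.

(** Rows of the table hold a twelfth of the number of row fillings, as a
    residue. *)
Definition entry_at (x z y : word) (v : residue) :=
  12 %| row_fillings x y z /\ v = residue_of (row_fillings x y z %/ 12).

(** The trie [r] is the row [f(x, ., z)] of the table of row fillings; words
    that it does not contain have no fillings. *)
Definition row_ok (x z : word) (r : trie residue) :=
  forall y, size y = 9 ->
  if lookup r y is Some v then entry_at x z y v else row_fillings x y z = 0.

Lemma full_balanced V (t : trie V) w : full t 3 3 3 9 -> size w = 9 ->
  lookup t w = None -> ~~ balanced w.
Proof.
move=> F Sw N; apply/negP => bw.
by apply: (full_lookup F Sw) N; apply: balanced_count.
Qed.

Lemma row_ok_full x z r : full r 3 3 3 9 -> entries_in (entry_at x z) r -> row_ok x z r.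
Proof.
move=> F H y Sy; case E: (lookup r y) => [v|]; first exact: H.
exact/row_fillings_unbalanced2/(full_balanced F).
Qed.

(** By [row_fillings_std] the number of fillings is 6 times the number counted
    here, which is even at the partitions below, hence 12 times its half. *)
Definition base_row (x : word) : trie residue :=
  let D := second_colouring_counts x in
  foldl (fun t y => insert_recolourings y (residue_of (count_transversals unrestricted y D)./2) t)
        Empty partition_words.

Lemma second_colouring_countsE x q : size x = 9 -> size q = 9 ->
  odflt 0 (lookup (second_colouring_counts x) q) = count_mem q (second_colourings x).
Proof.
move=> Sx Sq.
have Sl l : l \in second_colourings x -> size l = 9.
  case/flatten_mapP => s; rewrite mem_filter mem_unrestricted => /and3P[_ /eqP Ss _].
  case/mapP => r; rewrite mem_filter mem_unrestricted Sx => /and3P[_ /eqP Sr _] ->.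
  by rewrite size_third_word Sr.
suff H t s : {in s, forall l, size l = 9} ->
    odflt 0 (lookup (foldl (fun t q => insert q (odflt 0 (lookup t q)).+1 t) t s) q) =
    odflt 0 (lookup t q) + count_mem q s.
  by rewrite /second_colouring_counts H // lookup_Empty.
elim: s t => [|l s IH] t Ss; first by rewrite addn0.
rewrite [LHS]IH => [|l' l's]; last by apply: Ss; rewrite inE l's orbT.
rewrite lookup_insert ?Sq ?(Ss l (mem_head _ _)) //= addnA; congr (_ + _).
by case: eqP => [->|_]; rewrite ?addn1 ?addn0.
Qed.

Lemma count_transversals_second x y : size x = 9 -> size y = 9 ->
  count_transversals unrestricted y (second_colouring_counts x) =
    count (fun q => transversal q y) (second_colourings x).
Proof.
move=> Sx Sy; rewrite count_transversalsE.
rewrite (eq_big_seq (fun q => \sum_(l <- second_colourings x) (l == q))); last first.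
  move=> q; rewrite mem_unrestricted Sy => /andP[/eqP Sq _].
  by rewrite second_colouring_countsE // -sum1_count big_mkcond; apply: eq_bigr => l _ /=;
    case: (l == q).
rewrite exchange_big -sum1_count [RHS]big_mkcond; apply: eq_big_seq => l lx /=.
have Sl : size l = 9.
  case/flatten_mapP: lx => s; rewrite mem_filter mem_unrestricted => /and3P[_ /eqP Ss _].
  case/mapP => r; rewrite mem_filter mem_unrestricted Sx => /and3P[_ /eqP Sr _] ->.
  by rewrite size_third_word Sr.
transitivity (count_mem l (transversals unrestricted y)).
  by rewrite -sum1_count [RHS]big_mkcond; apply: eq_bigr => q _ /=; rewrite eq_sym;
    case: (q == l).
by rewrite count_uniq_mem ?uniq_unrestricted // mem_unrestricted Sl Sy eqxx;
  case: (transversal l y).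
Qed.

Lemma entries_Empty V Q : entries_in Q (Empty : trie V).
Proof. by move=> w v _; rewrite lookup_Empty. Qed.

Lemma Forall_in (I : eqType) (P : I -> Prop) (s : seq I) :
  {in s, forall i, P i} -> List.Forall P s.
Proof.
elim: s => [|i s IH] H; first by constructor.
by constructor; [apply/H/mem_head|apply: IH => j js; apply: H; rewrite inE js orbT].
Qed.

(** The property of the entries is asked for by [Forall] because entries may
    contain tries, which carry no decidable equality. *)
Lemma entries_foldl (V I : Type) (Q : word -> V -> Prop) (s : seq I) key val t :
  List.Forall (fun i => size (key i) = 9 /\
    forall p, p \in recolourings -> Q (map (recolour p) (key i)) (val i)) s ->
  entries_in Q t ->
  entries_in Q (foldl (fun t i => insert_recolourings (key i) (val i) t) t s).
Proof.
move=> H; elim: H t => [|i s' [Si Qi] _ IH] t Qt //=.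
by apply: IH; apply: entries_insert_recolourings.
Qed.

Lemma entry_at_recolour2 x z y v pi : injective pi -> entry_at x z y v ->
  entry_at x z (map pi y) v.
Proof. by move=> pi_inj; rewrite /entry_at row_fillings_recolour2. Qed.

Lemma base_row_ok x : size x = 9 -> full (base_row x) 3 3 3 9 ->
  all (fun y => ~~ odd (count_transversals unrestricted y (second_colouring_counts x)))
    partition_words ->
  row_ok x std (base_row x).
Proof.
move=> Sx F /allP even; apply: (row_ok_full F) => {F}.
apply: entries_foldl; last exact: entries_Empty.
apply: Forall_in => y yP; have Sy := partition_words_size yP.
split=> [|p]; first exact: Sy.
move=>  /recolour_inj pi_inj; apply: (entry_at_recolour2 pi_inj).
have := even y yP; rewrite count_transversals_second // /entry_at row_fillings_std //.
move: (count _ _) => n /negbTE n_even.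
rewrite -{1 3}(odd_double_half n) n_even add0n -muln2 [n./2 * 2]mulnC mulnA.
by rewrite dvdn_mulr // mulKn.
Qed.

(** * Spreading the rows along the symmetries of the standard partition *)
Lemma size_swap_at T i (w : seq T) : size (swap_at i w) = size w.
Proof. by elim: i w => [|i IH] [|x [|y w]] //=; rewrite IH. Qed.

Lemma swap_atK T i : involutive (@swap_at T i).
Proof. by elim: i => [|i IH] [|x [|y w]] //=; rewrite IH. Qed.

Lemma map_swap_at T U (f : T -> U) i w : map f (swap_at i w) = swap_at i (map f w).
Proof. by elim: i w => [|i IH] [|x [|y w]] //=; rewrite IH. Qed.

Lemma perm_swap_at (T : eqType) i (w : seq T) : perm_eq (swap_at i w) w.
Proof.
elim: i w => [|i IH] [|x w] //=; last by rewrite perm_cons.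
by case: w => [|y w] //; apply/permPl/(perm_catCA [:: y] [:: x] w).
Qed.

(** A permutation of the digits written as a product of exchanges of adjacent
    digits, which is how it acts on tries. *)
Definition swap_along (T : Type) (s : seq nat) (w : seq T) := foldl (fun w i => swap_at i w) w s.

Lemma permute_iota w : size w = 9 -> permute (iota 0 9) w = w.
Proof. by move=> Sw; rewrite -[RHS](mkseq_nth T0) Sw. Qed.

Lemma swap_at_permute i w : size w = 9 -> swap_at i w = permute (swap_at i (iota 0 9)) w.
Proof. by move=> Sw; rewrite /permute map_swap_at -/(permute _ w) permute_iota. Qed.

Lemma row_fillings_swap_at i a b c : size a = 9 -> size b = 9 -> size c = 9 ->
  row_fillings (swap_at i a) (swap_at i b) (swap_at i c) = row_fillings a b c.
Proof.
by move=> Sa Sb Sc; rewrite !swap_at_permute // row_fillings_permute // perm_swap_at.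
Qed.

Lemma recoloured_refl w : recoloured w w.
Proof. by exists id; rewrite ?map_id. Qed.
Lemma recoloured_trans w w' w'' : recoloured w w' -> recoloured w' w'' -> recoloured w w''.
Proof.
by case=> pi pi_inj -> [rho rho_inj ->]; exists (rho \o pi); [apply: inj_comp | rewrite map_comp].
Qed.
Lemma recoloured_swap_at i w w' : recoloured w w' -> recoloured (swap_at i w) (swap_at i w').
Proof. by case=> pi pi_inj ->; exists pi; rewrite ?map_swap_at. Qed.
Lemma recoloured_permute h w w' : size w = 9 -> perm_eq h (iota 0 9) -> recoloured w w' ->
  recoloured (permute h w) (permute h w').
Proof.
move=> Sw hP [pi pi_inj ->]; exists pi => //; rewrite /permute -map_comp; apply/eq_in_map => i.
by rewrite (perm_mem hP) mem_iota => /andP[_ Hi] /=; rewrite (nth_map T0) ?Sw.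
Qed.

Definition same_partition (w w' : word) : bool :=
  has (fun p => map (recolour p) w == w') recolourings.
Lemma same_partitionP w w' : same_partition w w' -> recoloured w w'.
Proof. by case/hasP => p /recolour_inj pi_inj /eqP <-; exists (recolour p). Qed.

(** What the search keeps about a colouring [x]: the row [f(x, ., std)], the
    representative [x0] whose row it came from and the permutation [h] of the
    digits, fixing the partition [std], that carried [x0] to [x]. *)
Definition payload := (trie residue * (word * seq nat))%type.
Definition step (e : word * payload) (i : nat) : word * payload :=
  let: (x, (row, (x0, h))) := e in
  (swap_at i x, (swap_levels i row, (x0, swap_at i h))).
Definition steps (s : seq nat) (e : word * payload) := foldl step e s.

(** One partition from each of the five orbits of the stabiliser of [std]. *)
Definition representatives : seq word :=
  [:: std;
      [:: T0; T0; T0; T1; T1; T2; T1; T2; T2];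
      [:: T0; T0; T1; T0; T1; T2; T1; T2; T2];
      [:: T0; T0; T1; T0; T2; T2; T1; T1; T2];
      [:: T0; T1; T2; T0; T1; T2; T0; T1; T2]].

(** Generators of the stabiliser of [std]: exchanges of adjacent digits within
    a class, and the two exchanges of neighbouring classes. *)
Definition std_symmetries : seq (seq nat) :=
  [:: [:: 0]; [:: 1]; [:: 3]; [:: 4]; [:: 6]; [:: 7];
      [:: 2; 1; 0; 3; 2; 1; 4; 3; 2]; [:: 5; 4; 3; 6; 5; 4; 7; 6; 5]].

Definition record_entry (T : trie payload) (e : word * payload) := insert_recolourings e.1 e.2 T.

Definition explore (e : word * payload) (qT : seq (word * payload) * trie payload)
    (s : seq nat) :=
  let e' := steps s e in
  if lookup qT.2 e'.1 is Some _ then qT else (rcons qT.1 e', record_entry qT.2 e').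

(** Breadth-first search with fuel [n]: [queue] holds the nodes whose images
    under the generators are still to be explored, [done] the explored ones. *)
Fixpoint grow (n : nat) (queue done : seq (word * payload)) (T : trie payload) :=
  match n, queue with
  | n'.+1, e :: q =>
    let: (q', T') := foldl (explore e) (q, T) std_symmetries in grow n' q' (e :: done) T'
  | _, _ => (done, T)
  end.

Definition start : seq (word * payload) :=
  [seq (x, (base_row x, (x, iota 0 9))) | x <- representatives].
(** Each of the 280 partitions enters the queue once, so fuel 300 suffices;
    that nothing is missing is checked in [orbit_trie_full]. *)
Definition search : seq (word * payload) * trie payload :=
  grow 300 start [::] (foldl record_entry Empty start).
Definition orbit_trie : trie payload := search.2.

(** The whole table, moved along [s] from [std] to another third partition. *)
Definition table (s : seq nat) : trie (trie residue) :=
  foldl (fun T e => let e' := steps s e in insert_recolourings e'.1 e'.2.1 T) Empty search.1.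

(** The meaning of a payload, with a third partition [z] instead of [std]
    because the single exchanges of digits do not fix [std]. *)
Definition reaches (z : word) (x : word) (v : payload) :=
  let: (row, (x0, h)) := v in
  [/\ row_ok x z row, x0 \in representatives, perm_eq h (iota 0 9),
      recoloured (permute h x0) x & recoloured (permute h std) z].

Lemma row_ok_swap i x z r : i < 8 -> size x = 9 -> size z = 9 ->
  row_ok x z r -> row_ok (swap_at i x) (swap_at i z) (swap_levels i r).
Proof.
move=> Hi Sx Sz ok y Sy; rewrite lookup_swap_levels ?Sy //.
have := ok (swap_at i y); rewrite size_swap_at => /(_ Sy).
have E : row_fillings (swap_at i x) y (swap_at i z) = row_fillings x (swap_at i y) z.
  by rewrite -{1}[y](swap_atK i) row_fillings_swap_at ?size_swap_at.
by rewrite /entry_at E.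
Qed.

Lemma row_ok_recolour1 x z r pi : injective pi -> row_ok x z r -> row_ok (map pi x) z r.
Proof. by move=> pi_inj ok y /ok; rewrite /entry_at row_fillings_recolour1. Qed.
Lemma row_ok_recolour3 x z r pi : injective pi -> row_ok x z r -> row_ok x (map pi z) r.
Proof. by move=> pi_inj ok y /ok; rewrite /entry_at row_fillings_recolour3. Qed.

Definition entry_ok (z : word) (e : word * payload) := size e.1 = 9 /\ reaches z e.1 e.2.

Lemma step_ok i z e : i < 8 -> size z = 9 -> entry_ok z e -> entry_ok (swap_at i z) (step e i).
Proof.
case: e => x [row [x0 h]] Hi Sz [/= Sx [ok x0R hP hx hs]].
split; rewrite /= ?size_swap_at //; split => //.
- exact: row_ok_swap.
- by rewrite (perm_trans (perm_swap_at _ _) hP).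
- by rewrite /permute map_swap_at; apply: recoloured_swap_at.
- by rewrite /permute map_swap_at; apply: recoloured_swap_at.
Qed.

Lemma steps_ok s z e : all (fun i => i < 8) s -> size z = 9 -> entry_ok z e ->
  entry_ok (swap_along s z) (steps s e).
Proof.
elim: s z e => [//|i s IH] z e /= /andP[Hi Hs] Sz ok.
by apply: IH; rewrite ?size_swap_at //; apply: step_ok.
Qed.

Lemma reaches_recolour1 z x v pi : injective pi -> reaches z x v -> reaches z (map pi x) v.
Proof.
case: v => row [x0 h] pi_inj [ok x0R hP hx hs]; split=> //; first exact: row_ok_recolour1.
by apply: recoloured_trans hx _; exists pi.
Qed.

Lemma reaches_recolour3 z x v pi : injective pi -> reaches z x v -> reaches (map pi z) x v.
Proof.
case: v => row [x0 h] pi_inj [ok x0R hP hx hs]; split=> //; first exact: row_ok_recolour3.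
by apply: recoloured_trans hs _; exists pi.
Qed.

Lemma std_symmetriesP s : s \in std_symmetries ->
  all (fun i => i < 8) s && same_partition (swap_along s std) std.
Proof.
move: s; apply/allP; by vm_compute.
Qed.

(** A symmetry returns to [std] up to the names of the colours, which row
    fillings do not depend on. *)
Lemma std_symmetry_ok s e : s \in std_symmetries -> entry_ok std e -> entry_ok std (steps s e).
Proof.
move=> /std_symmetriesP/andP[Hs /same_partitionP[pi pi_inj Es]] ok.
have [Sx R] := steps_ok Hs (erefl : size std = 9) ok.
by split=> //; rewrite Es; apply: reaches_recolour3.
Qed.

Lemma record_ok T e : entry_ok std e ->
  entries_in (reaches std) T -> entries_in (reaches std) (record_entry T e).
Proof.
case=> Sx R HT; apply: entries_insert_recolourings => // p /recolour_inj pi_inj.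
exact: reaches_recolour1.
Qed.

Definition search_ok (qT : seq (word * payload) * trie payload) :=
  List.Forall (entry_ok std) qT.1 /\ entries_in (reaches std) qT.2.

Lemma Forall_rcons (I : Type) (Q : I -> Prop) s x :
  List.Forall Q s -> Q x -> List.Forall Q (rcons s x).
Proof. by move=> Hs Hx; elim: Hs => [|y s' Hy _ IH] /=; constructor. Qed.

Lemma explore_ok e qT s : s \in std_symmetries -> entry_ok std e -> search_ok qT ->
  search_ok (explore e qT s).
Proof.
move=> sS ok [Hq HT]; rewrite /explore; case: lookup => // .
have ok' := std_symmetry_ok sS ok.
by split; [apply: Forall_rcons | apply: record_ok].
Qed.

Lemma grow_ok n q d T : search_ok (q, T) -> List.Forall (entry_ok std) d ->
  search_ok (grow n q d T).
Proof.
elim: n q d T => [|n IH] [|e q] d T [Hq HT] Hd; try by split.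
have He := List.Forall_inv Hq; have {}Hq := List.Forall_inv_tail Hq.
rewrite -[grow _ _ _ _]/(let: (q', T') := foldl (explore e) (q, T) std_symmetries in
  grow n q' (e :: d) T').
have: search_ok (foldl (explore e) (q, T) std_symmetries).
  have: search_ok (q, T) by [].
  have: {subset std_symmetries <= std_symmetries} by [].
  elim: {1 3}std_symmetries (q, T) => [//|s S IHs] qT HS ok /=.
  apply: IHs => [u uS|]; first by apply: HS; rewrite inE uS orbT.
  by apply: explore_ok => //; apply: HS; apply: mem_head.
case: (foldl _ _ _) => q' T' ok; apply: IH => //; exact: List.Forall_cons.
Qed.

Lemma representatives_balanced : all balanced representatives. Proof. by vm_compute. Qed.

Lemma base_rows_checked : all (fun x => full (base_row x) 3 3 3 9 &&
  all (fun y => ~~ odd (count_transversals unrestricted y (second_colouring_counts x)))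
    partition_words) representatives.
Proof. by vm_cast_no_check (erefl true). Qed.

Lemma orbit_trie_full : full orbit_trie 3 3 3 9.
Proof. by vm_cast_no_check (erefl true). Qed.

Lemma representative_size x : x \in representatives -> size x = 9.
Proof. by move=> xR; apply/balanced_size/(allP representatives_balanced). Qed.

Lemma start_ok : List.Forall (entry_ok std) start.
Proof.
have H : {in representatives, forall x, entry_ok std (x, (base_row x, (x, iota 0 9)))}.
  move=> x xR; have Sx := representative_size xR; have /andP[F E] := allP base_rows_checked x xR.
  split; first exact: Sx.
  split; [exact: (base_row_ok Sx F E) | exact: xR | exact: perm_refl | |].
    by rewrite (permute_iota Sx); exact: recoloured_refl.
  by rewrite (permute_iota (erefl : size std = 9)); exact: recoloured_refl.
rewrite /start; elim: representatives H => [|x s IH] H; constructor; first by apply/H/mem_head.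
by apply: IH => y ys; apply: H; rewrite inE ys orbT.
Qed.

Lemma records_ok (s : seq (word * payload)) T : List.Forall (entry_ok std) s ->
  entries_in (reaches std) T -> entries_in (reaches std) (foldl record_entry T s).
Proof. by move=> H; elim: H T => [//|e s' ok _ IH] T HT; apply: IH; apply: record_ok. Qed.

Lemma search_okP : search_ok search.
Proof.
apply: grow_ok; last by constructor.
split; first exact: start_ok.
exact: (records_ok start_ok (@entries_Empty _ _)).
Qed.

Lemma orbit_trie_ok : entries_in (reaches std) orbit_trie.
Proof. exact: search_okP.2. Qed.

Lemma orbit_trieP x : balanced x ->
  exists row x0 h, [/\ lookup orbit_trie x = Some (row, (x0, h)), x0 \in representatives,
    perm_eq h (iota 0 9),
    recoloured (permute h x0) x & recoloured (permute h std) std].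
Proof.
move=> bx; have Sx := balanced_size bx.
case E: (lookup orbit_trie x) => [[row [x0 h]]|]; last first.
  by have := full_balanced orbit_trie_full Sx E; rewrite bx.
have [_ x0R hP hx hs] := orbit_trie_ok Sx E.
exists row, x0, h; split; [exact: erefl | exact: x0R | exact: hP | exact: hx | exact: hs].
Qed.

(** * Evaluating the number of completions *)
Definition table_ok (z : word) (T : trie (trie residue)) :=
  forall x, size x = 9 ->
  if lookup T x is Some r then row_ok x z r else ~~ balanced x.

Lemma table_okP s : all (fun i => i < 8) s -> full (table s) 3 3 3 9 ->
  table_ok (swap_along s std) (table s).
Proof.
move=> Hs F x Sx; case E: (lookup (table s) x) => [r|]; last exact: full_balanced F Sx E.
move: x r Sx E => {F}; apply: entries_foldl; last exact: entries_Empty.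
apply: List.Forall_impl search_okP.1 => e ok.
have [Sx] := steps_ok Hs (erefl : size std = 9) ok.
case: (steps s e) Sx => x [r [x0 h]] /= Sx [rok _ _ _ _]; split; first exact: Sx.
by move=> p /recolour_inj pi_inj; exact: (row_ok_recolour1 pi_inj).
Qed.

Lemma table_ok_recoloured z z' T : recoloured z z' -> table_ok z T -> table_ok z' T.
Proof.
case=> pi pi_inj -> ok x Sx; have := ok x Sx; case: lookup => // r.
exact: row_ok_recolour3.
Qed.

Definition reduced_fillings a b c := row_fillings a b c %/ 12.

Lemma table_ok_fillings z T x y : table_ok z T -> size x = 9 -> size y = 9 ->
  row_fillings x y z = 12 * reduced_fillings x y z.
Proof.
move=> ok Sx Sy; rewrite mulnC divnK //; have := ok x Sx; case: lookup => [r|ux].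
  by move=> /(_ y Sy); case: lookup => [v [] //|->].
by rewrite row_fillings_unbalanced1.
Qed.

(** Words at which one of the tries has no entry contribute a product with a
    zero factor. *)
Lemma walk_rows z z' x x' y r r' n : size y = 9 -> row_ok x z r -> row_ok x' z' r' ->
  walk fma y r r' (residue_of n) =
  residue_of (n + \sum_(q <- complements y) reduced_fillings x q.1 z * reduced_fillings x' q.2
    z').
Proof.
move=> Sy ok ok'; rewrite walkE.
have: {in complements y, forall q, size q.1 = 9 /\ size q.2 = 9}.
  by move=> [m b]; rewrite mem_complements => /rainbow_size[-> ->].
elim: (complements y) => [|q s IH] Hs /=; first by rewrite big_nil addn0.
rewrite big_cons IH => [|u us]; last by apply: Hs; rewrite inE us orbT.
have [S1 S2] := Hs q (mem_head _ _).
have := ok q.1 S1; have := ok' q.2 S2; rewrite /at_leaf /reduced_fillings.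
case: (lookup r q.1) => [v|]; case: (lookup r' q.2) => [v'|].
- by move=> [_ ->] [_ ->]; rewrite fmaE -addnA [X in n + X]addnC.
- by move=> -> _; rewrite div0n muln0.
- by move=> _ ->; rewrite div0n mul0n.
- by move=> _ ->; rewrite div0n mul0n.
Qed.

(** A table is a trie of tries, so two nested walks run over the complements of
    [x] and of [y]. *)
Definition walk_pair (x y : word) (t u : trie (trie residue)) acc : residue :=
  walk (walk fma y) x t u acc.

(** The part of the number of completions for which the pair [s] of colourings
    completes the third block. *)
Definition pair_sum x y (s : word * word) : nat :=
  \sum_(p <- complements x) \sum_(q <- complements y)
     row_fillings p.1 q.1 s.1 * row_fillings p.2 q.2 s.2.

Definition reduced_pair_sum x y (s : word * word) : nat :=
  \sum_(p <- complements x) \sum_(q <- complements y)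
     reduced_fillings p.1 q.1 s.1 * reduced_fillings p.2 q.2 s.2.

Lemma walk_pairE z z' x y T U n : size x = 9 -> size y = 9 -> table_ok z T -> table_ok z' U ->
  walk_pair x y T U (residue_of n) = residue_of (n + reduced_pair_sum x y (z, z')).
Proof.
move=> Sx Sy ok ok'; rewrite /walk_pair walkE /reduced_pair_sum.
have: {in complements x, forall q, size q.1 = 9 /\ size q.2 = 9}.
  by move=> [m b]; rewrite mem_complements => /rainbow_size[-> ->].
elim: (complements x) => [|p s IH] Hs /=; first by rewrite big_nil addn0.
rewrite big_cons IH => [|u us]; last by apply: Hs; rewrite inE us orbT.
have [S1 S2] := Hs p (mem_head _ _).
have := ok p.1 S1; have := ok' p.2 S2; rewrite /at_leaf.
have zero1 w : ~~ balanced p.1 -> reduced_fillings p.1 w z = 0.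
  by move=> up; rewrite /reduced_fillings row_fillings_unbalanced1.
have zero2 w : ~~ balanced p.2 -> reduced_fillings p.2 w z' = 0.
  by move=> up; rewrite /reduced_fillings row_fillings_unbalanced1.
case: (lookup T p.1) => [r|]; case: (lookup U p.2) => [r'|].
- by move=> rok' rok; rewrite (walk_rows _ Sy rok rok') -addnA [X in n + X]addnC.
- by move=> up _; rewrite [X in n + (X + _)]big1 // => q _; rewrite zero2 ?muln0.
- by move=> _ up; rewrite [X in n + (X + _)]big1 // => q _; rewrite zero1.
- by move=> _ up; rewrite [X in n + (X + _)]big1 // => q _; rewrite zero1.
Qed.

Lemma pair_sum_reduced z z' x y T U : size x = 9 -> size y = 9 -> table_ok z T -> table_ok z' U ->
  pair_sum x y (z, z') = 144 * reduced_pair_sum x y (z, z').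
Proof.
move=> Sx Sy ok ok'; rewrite /pair_sum /reduced_pair_sum big_distrr big_seq [RHS]big_seq /=.
apply: eq_bigr => -[m b]; rewrite mem_complements => /rainbow_size[Sm Sb].
rewrite big_distrr big_seq [RHS]big_seq /=.
apply: eq_bigr => -[m' b']; rewrite mem_complements => /rainbow_size[Sm' Sb'].
by rewrite /= (table_ok_fillings ok) ?(table_ok_fillings ok') ?Sm ?Sb ?Sm' ?Sb' // mulnACA.
Qed.

Definition transpose (i j k : nat) := if k == i then j else if k == j then i else k.
(** The products of a transposition (or the identity) within each class of
    [std], taking the digits 2, 5, 6 to the 27 choices of one digit from each
    class. *)
Definition block_transpositions : seq (seq nat) :=
  [seq [seq transpose 2 i (transpose 5 jk.1 (transpose 6 jk.2 k)) | k <- iota 0 9]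
     | i <- [:: 0; 1; 2], jk <- [seq (j, k) | j <- [:: 3; 4; 5], k <- [:: 6; 7; 8]]].

(** A complement of [std] shifts the colour of every digit by 1 or by 2,
    cyclically, in its first component, and by the other amount in the second.
    The first component is balanced iff the digits shifted by 1 are equally many
    in the three classes: [1 + 27 + 27 + 1] choices.  If there are none or three
    in each class, both components are recolourings of [std]; this gives
    [rotated_pair] and its exchange.  If there is one in each class, say 2, 5
    and 6, the components are [std] with these digits cycled in either
    direction; this gives [cycled_pair], its images under
    [block_transpositions], and the exchanges of those. *)
Definition rotated_pair : word * word :=
  ([:: T1; T1; T1; T2; T2; T2; T0; T0; T0], [:: T2; T2; T2; T0; T0; T0; T1; T1; T1]).
Definition cycled_pair : word * word :=
  ([:: T2; T2; T1; T0; T0; T2; T0; T1; T1], [:: T1; T1; T2; T2; T2; T0; T1; T0; T0]).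

Definition permute_pair h (p : word * word) := (permute h p.1, permute h p.2).
Definition half_complements : seq (word * word) :=
  rotated_pair :: [seq permute_pair g cycled_pair | g <- block_transpositions].

Lemma complements_std :
  perm_eq [seq s <- complements std | balanced s.1 && balanced s.2]
          (half_complements ++ [seq (s.2, s.1) | s <- half_complements]).
Proof. by vm_cast_no_check (erefl true). Qed.

Lemma block_transpositionsP : all (fun g => perm_eq g (iota 0 9) &&
  (permute_pair g (permute_pair g cycled_pair) == cycled_pair)) block_transpositions.
Proof. by vm_compute. Qed.

(** Exchanging the middle and the bottom band. *)
Lemma pair_sum_swap x y s : pair_sum x y (s.2, s.1) = pair_sum x y s.
Proof.
have Hp c : perm_eq [seq (p.2, p.1) | p <- complements c] (complements c).
  apply: perm_map_stable; first exact: uniq_complements.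
    by move=> [m b]; rewrite !mem_complements rainbow_swap23.
  by move=> [m b] [m' b'] _ _ [-> ->].
rewrite /pair_sum -[RHS](perm_big _ (Hp x)) big_map; apply: eq_bigr => p _.
by rewrite -[RHS](perm_big _ (Hp y)) big_map; apply: eq_bigr => q _; rewrite mulnC.
Qed.

Lemma pair_sum_permute h x y s : perm_eq h (iota 0 9) -> size x = 9 -> size y = 9 ->
  size s.1 = 9 -> size s.2 = 9 ->
  pair_sum (permute h x) (permute h y) (permute_pair h s) = pair_sum x y s.
Proof.
move=> hP Sx Sy S1 S2; rewrite /pair_sum.
rewrite (perm_big _ (perm_complements_permute hP Sx)) big_map /=.
rewrite big_seq [RHS]big_seq; apply: eq_bigr => -[m b];
  rewrite mem_complements => /rainbow_size[Sm Sb].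
rewrite (perm_big _ (perm_complements_permute hP Sy)) big_map /=.
rewrite big_seq [RHS]big_seq; apply: eq_bigr => -[m' b'];
  rewrite mem_complements => /rainbow_size[Sm' Sb'].
by rewrite /= !row_fillings_permute ?Sm ?Sb ?Sm' ?Sb'.
Qed.

Lemma completion_count_std x y : completion_count x y std =
  2 * (pair_sum x y rotated_pair +
       \sum_(g <- block_transpositions) pair_sum x y (permute_pair g cycled_pair)).
Proof.
have -> : completion_count x y std = \sum_(s <- complements std) pair_sum x y s.
  rewrite /completion_count; under eq_bigr => p _ do rewrite exchange_big.
  by rewrite exchange_big.
rewrite (bigID (fun s => balanced s.1 && balanced s.2)).
have -> : \sum_(s <- complements std | ~~ (balanced s.1 && balanced s.2)) pair_sum x y s = 0.
  rewrite big_seq_cond; apply: big1 => -[m b].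
  rewrite mem_complements => /andP[/rainbow_size[Sm Sb]]; rewrite negb_and => H.
  rewrite /pair_sum big1 // => p _; rewrite big1 // => q _.
  case/orP: H => H; first by rewrite [X in X * _]row_fillings_unbalanced3 ?Sm.
  by rewrite [X in _ * X]row_fillings_unbalanced3 ?muln0 ?Sb.
rewrite [LHS]addn0.
rewrite -big_filter (perm_big _ complements_std) big_cat big_map.
rewrite [X in (_ + X)%N = _](eq_bigr _ (fun s _ => pair_sum_swap x y s)).
by rewrite addnn -mul2n /half_complements big_cons big_map.
Qed.

(** The 3-cycle of the digits 2, 5, 6 and its inverse: the exchanges 2, 3, 4, 3,
    2 make the transposition of 2 and 5, and the exchange 5 that of 5 and 6. *)
Definition middle_swaps := [:: 5; 2; 3; 4; 3; 2].
Definition bottom_swaps := [:: 2; 3; 4; 3; 2; 5].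
Definition std_table := table [::].
Definition middle_table := table middle_swaps.
Definition bottom_table := table bottom_swaps.

Lemma tables_full : [&& full std_table 3 3 3 9,
  full middle_table 3 3 3 9 & full bottom_table 3 3 3 9].
Proof. by vm_cast_no_check (erefl true). Qed.

Lemma std_table_ok : table_ok std std_table.
Proof. by apply: (@table_okP [::]) => //; case/and3P: tables_full. Qed.

Lemma rotated_recoloured : same_partition std rotated_pair.1 && same_partition std rotated_pair.2.
Proof. by vm_compute. Qed.

Lemma cycled_recoloured : same_partition (swap_along middle_swaps std) cycled_pair.1 &&
  same_partition (swap_along bottom_swaps std) cycled_pair.2.
Proof. by vm_compute. Qed.

Lemma middle_table_ok : table_ok cycled_pair.1 middle_table.
Proof.
case/andP: cycled_recoloured => /same_partitionP H _; apply: table_ok_recoloured H _.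
by apply: table_okP => //; case/and3P: tables_full.
Qed.

Lemma bottom_table_ok : table_ok cycled_pair.2 bottom_table.
Proof.
case/andP: cycled_recoloured => _ /same_partitionP H; apply: table_ok_recoloured H _.
by apply: table_okP => //; case/and3P: tables_full.
Qed.

(** The images of [cycled_pair] need no tables of their own: permuting [x] and
    [y] instead has the same effect, as the permutations are involutions. *)
Definition completion_residue (x y : word) : residue :=
  foldr (fun g => walk_pair (permute g x) (permute g y) middle_table bottom_table)
        (walk_pair x y std_table std_table (residue_of 0)) block_transpositions.

(** The factor [288 = 2 * 12 * 12] consists of the exchange of the pairs and of
    the factor 12 in both row fillings. *)
Lemma completion_residueP x y : size x = 9 -> size y = 9 ->
  exists2 n, completion_count x y std = 288 * n & completion_residue x y = residue_of n.
Proof.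
move=> Sx Sy; case/andP: rotated_recoloured => /same_partitionP R1 /same_partitionP R2.
have ok1 := table_ok_recoloured R1 std_table_ok; have ok2 := table_ok_recoloured R2 std_table_ok.
exists (reduced_pair_sum x y rotated_pair +
        \sum_(g <- block_transpositions) reduced_pair_sum (permute g x) (permute g y)
          cycled_pair).
  rewrite completion_count_std (pair_sum_reduced Sx Sy ok1 ok2) -[288]/(2 * 144) -mulnA;
    congr (_ * _).
  rewrite mulnDr; congr (_ + _); rewrite big_distrr; apply: eq_big_seq => g gM /=.
  have /andP[gP /eqP gg] := allP block_transpositionsP g gM.
  rewrite -(pair_sum_reduced _ _ middle_table_ok bottom_table_ok) ?size_permute //.
  by rewrite -(pair_sum_permute gP Sx Sy) ?size_permute // gg.
rewrite /completion_residue (walk_pairE 0 Sx Sy ok1 ok2) add0n.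
have: {in block_transpositions, forall g, perm_eq g (iota 0 9)}.
  by move=> g /(allP block_transpositionsP)/andP[].
elim: block_transpositions => [|g s IH] Hs; first by rewrite big_nil addn0.
rewrite [foldr _ _ _]/= IH => [|u us]; last by apply: Hs; rewrite inE us orbT.
have gP := Hs g (mem_head _ _).
rewrite (walk_pairE _ (size_permute gP x) (size_permute gP y) middle_table_ok bottom_table_ok)
  big_cons -addnA.
congr (residue_of (_ + _)); exact: addnC.
Qed.

(** * Forty-four seeds represent all triples *)

(** For each representative, permutations of the digits which fix both it and
    [std] as partitions ([stabiliserP]). *)
Definition stabilisers : seq (seq (seq nat)) :=
  [:: [:: [:: 0; 2; 1; 7; 6; 8; 5; 3; 4];
          [:: 6; 8; 7; 3; 4; 5; 1; 2; 0]];
      [:: [:: 1; 2; 0; 8; 7; 6; 5; 4; 3];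
          [:: 1; 0; 2; 7; 8; 6; 5; 3; 4];
          [:: 1; 2; 0; 4; 3; 5; 6; 7; 8]];
      [:: [:: 7; 8; 6; 5; 4; 3; 2; 0; 1];
          [:: 1; 0; 2; 3; 4; 5; 6; 7; 8]];
      [:: [:: 0; 1; 2; 3; 5; 4; 7; 6; 8];
          [:: 5; 4; 3; 8; 6; 7; 0; 1; 2]];
      [:: [:: 4; 3; 5; 1; 0; 2; 7; 6; 8];
          [:: 8; 7; 6; 2; 1; 0; 5; 4; 3]]].

(** For each representative, second partitions of the seeds in which it comes
    first and [std] third. *)
Definition partners : seq (seq word) :=
  [:: [:: [:: T0; T0; T0; T1; T1; T1; T2; T2; T2];
          [:: T0; T0; T0; T1; T1; T2; T1; T2; T2];
          [:: T0; T0; T1; T0; T1; T2; T1; T2; T2];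
          [:: T0; T0; T1; T0; T2; T2; T1; T1; T2];
          [:: T0; T1; T2; T0; T1; T2; T0; T1; T2]];
      [:: [:: T0; T0; T0; T1; T1; T2; T2; T1; T2];
          [:: T0; T0; T0; T1; T2; T1; T2; T1; T2];
          [:: T0; T0; T1; T0; T1; T1; T2; T2; T2];
          [:: T0; T0; T1; T0; T1; T2; T2; T1; T2];
          [:: T0; T0; T1; T0; T2; T1; T1; T2; T2];
          [:: T0; T0; T1; T0; T2; T1; T2; T1; T2];
          [:: T0; T0; T1; T0; T2; T2; T2; T1; T1];
          [:: T0; T0; T1; T1; T1; T0; T2; T2; T2];
          [:: T0; T0; T1; T1; T2; T0; T1; T2; T2];
          [:: T0; T0; T1; T1; T2; T0; T2; T1; T2];
          [:: T0; T1; T2; T0; T0; T1; T1; T2; T2];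
          [:: T0; T1; T2; T0; T0; T1; T2; T1; T2];
          [:: T0; T1; T2; T0; T1; T0; T2; T1; T2];
          [:: T0; T1; T2; T0; T1; T2; T2; T0; T1]];
      [:: [:: T0; T0; T1; T1; T0; T2; T2; T1; T2];
          [:: T0; T0; T1; T1; T1; T2; T2; T0; T2];
          [:: T0; T0; T1; T1; T2; T0; T1; T2; T2];
          [:: T0; T0; T1; T1; T2; T0; T2; T1; T2];
          [:: T0; T0; T1; T1; T2; T1; T2; T0; T2];
          [:: T0; T0; T1; T1; T2; T2; T2; T0; T1];
          [:: T0; T0; T1; T2; T0; T2; T1; T1; T2];
          [:: T0; T0; T1; T2; T1; T1; T0; T2; T2];
          [:: T0; T0; T1; T2; T1; T1; T2; T0; T2];
          [:: T0; T0; T1; T2; T1; T2; T2; T0; T1];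
          [:: T0; T1; T0; T0; T1; T2; T2; T1; T2];
          [:: T0; T1; T0; T0; T2; T1; T2; T1; T2];
          [:: T0; T1; T0; T1; T2; T0; T2; T1; T2];
          [:: T0; T1; T0; T1; T2; T1; T2; T0; T2];
          [:: T0; T1; T0; T1; T2; T2; T2; T0; T1];
          [:: T0; T1; T0; T2; T1; T0; T2; T1; T2];
          [:: T0; T1; T0; T2; T1; T1; T2; T0; T2];
          [:: T0; T1; T0; T2; T1; T2; T2; T0; T1];
          [:: T0; T1; T0; T2; T2; T1; T2; T0; T1];
          [:: T0; T1; T2; T2; T0; T1; T1; T0; T2]];
      [:: [:: T0; T0; T1; T2; T1; T1; T2; T2; T0];
          [:: T0; T1; T0; T1; T1; T2; T0; T2; T2];
          [:: T0; T1; T0; T2; T0; T2; T1; T2; T1];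
          [:: T0; T1; T2; T2; T0; T1; T0; T1; T2]];
      [:: [:: T0; T1; T2; T1; T2; T0; T2; T0; T1]]].

Definition seeds : seq (word * word) :=
  flatten [seq [seq (xs.1, y) | y <- xs.2] | xs <- zip representatives partners].

Lemma colour_partition_recoloured w w' : size w = 9 -> recoloured w w' ->
  colour_partition w' = colour_partition w.
Proof. by move=> Sw [pi pi_inj ->]; rewrite colour_partition_map. Qed.

(** A permutation of the digits that lists them class by class, hence carries
    the partition to [std]. *)
Definition sorting (c : word) : seq nat :=
  [seq i <- iota 0 9 | nth T0 c i == T0] ++ [seq i <- iota 0 9 | nth T0 c i == T1]
  ++ [seq i <- iota 0 9 | nth T0 c i == T2].
Definition inverse (h : seq nat) : seq nat := [seq index i h | i <- iota 0 9].

Lemma sorting_perm c : perm_eq (sorting c) (iota 0 9).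
Proof.
apply/seq.permP => P; rewrite /sorting !count_cat.
elim: (iota 0 9) => //= i s; case: (nth T0 c i) => /= <-.
- by rewrite -addnA.
- by rewrite -addnA addnCA.
- by rewrite [X in _ + X]addnCA addnCA.
Qed.

Lemma permute_sorting c : balanced c -> permute (sorting c) c = std.
Proof.
move=> bc; have Sc := balanced_size bc.
have E k : [seq nth T0 c i | i <- [seq i <- iota 0 9 | nth T0 c i == k]] = nseq 3 k.
  have H s : [seq nth T0 c i | i <- [seq i <- s | nth T0 c i == k]] =
             nseq (count_mem k [seq nth T0 c i | i <- s]) k.
    by elim: s => //= i s IH; case: eqP => //= ->; rewrite IH.
  by rewrite H -/(permute _ c) (permute_iota Sc) balanced_count.
by rewrite /permute /sorting !map_cat !E.
Qed.

Lemma inverse_perm h : perm_eq h (iota 0 9) -> perm_eq (inverse h) (iota 0 9).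
Proof.
move=> hP; have U : uniq (inverse h).
  rewrite map_inj_in_uniq ?iota_uniq // => i j; rewrite -!(perm_mem hP) => ih jh E.
  by rewrite -(nth_index 0 ih) E nth_index.
apply: uniq_perm; rewrite ?iota_uniq //.
have [] // := uniq_min_size U (s2 := iota 0 9).
move=> k /mapP[i]; rewrite -(perm_mem hP) -index_mem (size_h hP) => ih ->.
by rewrite mem_iota.
Qed.

Lemma permute_inverse h w : perm_eq h (iota 0 9) -> size w = 9 ->
  permute (inverse h) (permute h w) = w.
Proof.
move=> hP Sw; rewrite -[RHS](mkseq_nth T0) Sw /permute /inverse -map_comp.
apply/eq_in_map => i; rewrite -(perm_mem hP) => ih /=.
by rewrite (nth_map 0) ?index_mem // nth_index.
Qed.

(** An isomorphic triple with [std] as third and a representative as first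
    partition: sort the third partition, then undo the permutation which the
    search recorded for the first one. *)
Definition normalise (a b c : word) : option (word * word) :=
  let h := sorting c in
  if lookup orbit_trie (permute h a) is Some (_, (x, g)) then
    Some (x, permute (inverse g) (permute h b)) else None.

Lemma normaliseP a b c : balanced a -> balanced b -> balanced c ->
  exists x y, [/\ normalise a b c = Some (x, y), x \in representatives, balanced y &
                  isomorphic (triple a b c) (triple x y std)].
Proof.
move=> ba bb bc; have hP := sorting_perm c.
have ba' := balanced_permute hP ba; have bb' := balanced_permute hP bb.
have [row [x [g [E xR gP gx gs]]]] := orbit_trieP ba'.
have iP := inverse_perm gP; have Sx := representative_size xR.
exists x, (permute (inverse g) (permute (sorting c) b)); split => //.
- by rewrite /normalise E.
- exact: balanced_permute iP bb'.
(* First [sorting c] carries the third partition to [std] ... *)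
have i1 := isomorphic_permute hP (balanced_size ba) (balanced_size bb) (balanced_size bc).
rewrite permute_sorting // in i1; apply: isomorphic_trans i1 _.
(* ... then [inverse g], which fixes [std], carries the first one to [x]. *)
have i2 := isomorphic_permute iP (balanced_size ba') (balanced_size bb') (erefl : size std = 9).
apply: isomorphic_trans i2 _; rewrite /triple.
have -> : colour_partition (permute (inverse g) (permute (sorting c) a)) = colour_partition x.
  rewrite -[in RHS](permute_inverse gP Sx); apply: colour_partition_recoloured;
    first by rewrite size_permute.
  by apply: recoloured_permute; rewrite ?size_permute.
have -> : colour_partition (permute (inverse g) std) = colour_partition std.
  rewrite -[in RHS](permute_inverse gP (erefl : size std = 9));
    apply: colour_partition_recoloured.
    by rewrite size_permute.
  by apply: recoloured_permute; rewrite ?size_permute.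
exact/isomorphic_perm/perm_refl.
Qed.

Definition stabiliser (x : word) : seq (seq nat) := nth [::] stabilisers
  (index x representatives).

(** Isomorphic triples of the same form.  Besides the symmetries fixing the first
    and the third partition, these come from making the second partition the
    first, and from exchanging the last two, followed by normalisation. *)
Definition neighbours (xy : word * word) : seq (word * word) :=
  let: (x, y) := xy in
  [seq (x, permute g y) | g <- stabiliser x] ++ pmap id [:: normalise y x std; normalise x std y].

(** Pairs of words are recorded under their concatenation, with all colourings
    of the second word; the first one is a representative and stays as it is. *)
Definition mark (T : trie unit) (xy : word * word) : trie unit :=
  foldl (fun T p => insert (xy.1 ++ map (recolour p) xy.2) tt T) T recolourings.

Definition visit (qT : seq (word * word) * trie unit) (xy : word * word) :=
  if lookup qT.2 (xy.1 ++ xy.2) is Some _ then qT else (xy :: qT.1, mark qT.2 xy).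

Fixpoint spread (n : nat) (queue : seq (word * word)) (T : trie unit) : trie unit :=
  match n, queue with
  | n'.+1, xy :: q =>
      let: (q', T') := foldl visit (q, T) (neighbours xy) in spread n' q' T'
  | _, _ => T
  end.

(** There are [5 * 280] normalised triples, so fuel 1500 lets the search end. *)
Definition spread_seeds : trie unit := spread 1500 seeds (foldl mark Empty seeds).

Definition descend V (t : trie V) (w : word) : trie V := foldl (@child V) t w.

Definition reached (xy : word * word) : Prop :=
  [/\ xy.1 \in representatives, balanced xy.2 &
      exists2 s, s \in seeds & isomorphic (triple xy.1 xy.2 std) (triple s.1 s.2 std)].

Definition reached_in (T : trie unit) : Prop :=
  forall x y u, size x = 9 -> size y = 9 -> lookup T (x ++ y) = Some u -> reached (x, y).

Lemma stabiliserP x g : x \in representatives -> g \in stabiliser x ->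
  [&& perm_eq g (iota 0 9), same_partition (permute g x) x & same_partition (permute g std) std].
Proof.
move=> xR; move: g; apply/allP; move: x xR; apply/allP; by vm_compute.
Qed.

Lemma reached_stabiliser x y g : reached (x, y) -> g \in stabiliser x -> reached (x, permute g y).
Proof.
move=> [/= xR bY [s sS i]] gx; have /and3P[gP /same_partitionP Ex /same_partitionP Es] :=
  stabiliserP xR gx.
have Sx := representative_size xR.
split=> //=; first exact: balanced_permute.
exists s => //; apply: isomorphic_trans i; apply: isomorphic_sym.
have := isomorphic_permute gP Sx (balanced_size bY) (erefl : size std = 9).
by rewrite /triple -(colour_partition_recoloured _ Ex) ?size_permute //
  -(colour_partition_recoloured _ Es) ?size_permute.
Qed.

Lemma reached_normalise x y a b c uv : reached (x, y) ->
  balanced a -> balanced b -> balanced c -> perm_eq (triple a b c) (triple x y std) ->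
  normalise a b c = Some uv -> reached uv.
Proof.
move=> [/= xR bY [s sS i]] ba bb bc P; have [u [v [-> uR bv j]]] := normaliseP ba bb bc.
case=> <-; split=> //=; exists s => //.
by apply: isomorphic_trans (isomorphic_sym j) _; apply: isomorphic_trans (isomorphic_perm P) i.
Qed.

Lemma reached_neighbours xy uv : reached xy -> uv \in neighbours xy -> reached uv.
Proof.
case: xy => x y H; have [xR bY _] := H; rewrite /= in xR bY.
have bx : balanced x := allP representatives_balanced x xR.
rewrite mem_cat => /orP[/mapP[g gx ->]|]; first exact: reached_stabiliser.
rewrite mem_pmap map_id !inE => /orP[]/eqP/esym; apply: reached_normalise H _ _ _ _ => //.
  by apply/permPl/(perm_catCA [:: colour_partition y] [:: colour_partition x] [::
    colour_partition std]).
by rewrite /triple perm_cons; apply/permPl/(perm_catC [:: colour_partition std] [::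
  colour_partition y]).
Qed.

Lemma mark_ok T xy : reached xy -> reached_in T -> reached_in (mark T xy).
Proof.
case: xy => x y [/= xR bY [s sS i]] ok; rewrite /mark.
have Sx := representative_size xR; have Sy := balanced_size bY.
have: {subset recolourings <= recolourings} by [].
elim: {1 3}recolourings T ok => [//|p l IH] T ok sub.
apply: IH => [|q ql]; last by apply: sub; rewrite inE ql orbT.
move=> u v w Su Sv /=; rewrite lookup_insert ?size_cat ?size_map ?Su ?Sv ?Sx ?Sy //.
rewrite eqseq_cat ?Sx //; case: andP => [[/eqP <- /eqP <-] _|_]; last exact: ok.
have pi_inj := recolour_inj (sub p (mem_head _ _)).
split=> //=; first exact: balanced_map.
by exists s => //; rewrite /triple colour_partition_map.
Qed.

Lemma visit_ok qT xy : reached xy -> {in qT.1, forall uv, reached uv} -> reached_in qT.2 ->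
  {in (visit qT xy).1, forall uv, reached uv} /\ reached_in (visit qT xy).2.
Proof.
move=> H Hq HT; rewrite /visit; case: lookup => //; split; last exact: mark_ok.
by move=> uv; rewrite inE => /predU1P[->|/Hq].
Qed.

Lemma spread_ok n q T : {in q, forall uv, reached uv} ->
  reached_in T -> reached_in (spread n q T).
Proof.
elim: n q T => [|n IH] [|xy q] T //= Hq HT.
have H := Hq xy (mem_head _ _).
have: {in neighbours xy, forall uv, reached uv} by move=> uv; apply: reached_neighbours.
have: {in (q, T).1, forall uv, reached uv} /\ reached_in (q, T).2.
  by split=> // uv uvq; apply: Hq; rewrite inE uvq orbT.
elim: (neighbours xy) (q, T) => [|uv l IHl] qT [Hq' HT'] Hl.
  by case: qT Hq' HT' => q' T' /= Hq' HT'; apply: IH.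
apply: IHl; first by apply: visit_ok => //; apply: Hl; apply: mem_head.
by move=> u ul; apply: Hl; rewrite inE ul orbT.
Qed.

Lemma seeds_checked : all (fun s => (s.1 \in representatives) && balanced s.2) seeds.
Proof. by vm_compute. Qed.

Lemma seeds_reached s : s \in seeds -> reached s.
Proof.
move=> sS; have /andP[xR bY] := allP seeds_checked s sS.
by split=> //; exists s => //; apply/isomorphic_perm/perm_refl.
Qed.

Lemma spread_checked : all (fun x => full (descend spread_seeds x) 3 3 3 9) representatives.
Proof. by vm_cast_no_check (erefl true). Qed.

Lemma lookup_descend V (t : trie V) x y : lookup (descend t x) y = lookup t (x ++ y).
Proof. by elim: x t => //= u x IH t; rewrite -IH. Qed.

Lemma spread_seeds_ok : reached_in spread_seeds.
Proof.
apply: spread_ok => [s|]; first exact: seeds_reached.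
have: reached_in Empty by move=> x y u _ _; rewrite lookup_Empty.
have: {in seeds, forall s, reached s} by exact: seeds_reached.
elim: seeds Empty => [//|s l IH] T Hs HT; apply: IH.
  by move=> u ul; apply: Hs; rewrite inE ul orbT.
by apply: mark_ok => //; apply: Hs; apply: mem_head.
Qed.

Lemma all_reached x y : x \in representatives -> balanced y -> reached (x, y).
Proof.
move=> xR bY; have F := allP spread_checked x xR; have Sy := balanced_size bY.
case E: (lookup (descend spread_seeds x) y) => [u|]; last first.
  by have := full_balanced F Sy E; rewrite bY.
rewrite lookup_descend in E; exact: spread_seeds_ok (representative_size xR) Sy E.
Qed.

(** Normalising leaves [5 * 280] triples, and the search found all of them. *)
Lemma triple_seed a b c : balanced a -> balanced b -> balanced c ->
  exists2 s, s \in seeds & isomorphic (triple a b c) (triple s.1 s.2 std).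
Proof.
move=> ba bb bc; have [x [y [_ xR bY i]]] := normaliseP ba bb bc.
have [_ _ [s sS j]] := all_reached xR bY.
exists s; first exact: sS.
exact: isomorphic_trans i j.
Qed.

Local Open Scope fset_scope.
Local Open Scope mset_scope.
Local Open Scope nat_scope.

(** * The two classifications agree *)
Lemma size_seeds : size seeds = 44. Proof. by []. Qed.

Lemma residues_distinct :
  uniq [seq residue_nats (completion_residue s.1 s.2) | s <- seeds].
Proof. by vm_cast_no_check (erefl true). Qed.

(** By [row_fillings_std] each second row colouring transversal to the partner
    yields six bands that have the partitions of the seed. *)
Lemma seeds_have_rows :
  all (fun s => has (fun q => transversal q s.2) (second_colourings s.1)) seeds.
Proof. by vm_cast_no_check (erefl true). Qed.

Lemma uniq_map_inj (T U : eqType) (f : T -> U) (s : seq T) :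
  uniq (map f s) -> {in s &, injective f}.
Proof.
elim: s => [//|x s IH] /= /andP[xs Us] y z; rewrite !inE.
move=> /predU1P[->|ys] /predU1P[->|zs] // E; last exact: IH.
- by rewrite E map_f in xs.
- by rewrite -E map_f in xs.
Qed.

Lemma seed_size s : s \in seeds -> size s.1 = 9 /\ size s.2 = 9.
Proof. by case/seeds_reached => /representative_size S1 /balanced_size S2 _. Qed.

Lemma seed_balanced s : s \in seeds -> balanced s.1 /\ balanced s.2.
Proof. by case/seeds_reached => xR bY _; split; first exact: (allP representatives_balanced). Qed.

Lemma std_balanced : balanced std. Proof. by vm_compute. Qed.

Lemma seeds_completion_count_inj :
  {in seeds &, injective (fun s => completion_count s.1 s.2 std)}.
Proof.
move=> s t sS tS E; apply: (uniq_map_inj residues_distinct sS tS).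
have [S1 S2] := seed_size sS; have [U1 U2] := seed_size tS.
have [n En ->] := completion_residueP S1 S2; have [m Em ->] := completion_residueP U1 U2.
by rewrite En Em in E; move/eqP: E; rewrite eqn_pmul2l // => /eqP ->.
Qed.

Definition seed (i : 'I_44) : word * word := nth (std, std) seeds i.

Lemma seed_in i : seed i \in seeds.
Proof. by apply: mem_nth; rewrite size_seeds. Qed.

Lemma seeds_uniq : uniq seeds.
Proof. exact: map_uniq residues_distinct. Qed.

Definition seed_triple i := triple (seed i).1 (seed i).2 std.
Definition band_triple (B : band) := triple (cols B T0) (cols B T1) (cols B T2).

Lemma triple_seed_index a b c : balanced a -> balanced b -> balanced c ->
  exists i, isomorphic (triple a b c) (seed_triple i).
Proof.
move=> ba bb bc; have [s sS j] := triple_seed ba bb bc.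
have si : index s seeds < 44 by rewrite -size_seeds index_mem.
by exists (Ordinal si); rewrite /seed_triple /seed /= nth_index.
Qed.

Lemma seed_iso_eq i j : isomorphic (seed_triple i) (seed_triple j) -> i = j.
Proof.
have [b1 b2] := seed_balanced (seed_in i); have [b3 b4] := seed_balanced (seed_in j).
move/(completion_count_isomorphic b1 b2 std_balanced b3 b4 std_balanced).
move/(seeds_completion_count_inj (seed_in i) (seed_in j)) => E; apply: val_inj; apply/eqP.
by rewrite -(nth_uniq (std, std) _ _ seeds_uniq) ?size_seeds ?ltn_ord //; apply/eqP.
Qed.

Lemma band_index B : valid_band B -> exists i, isomorphic (band_triple B) (seed_triple i).
Proof. by move=> vB; apply: triple_seed_index; apply: cols_balanced. Qed.

Lemma card_completions_seed B i : valid_band B -> isomorphic (band_triple B) (seed_triple i) ->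
  #|completions B| = completion_count (seed i).1 (seed i).2 std.
Proof.
move=> vB; have [b1 b2] := seed_balanced (seed_in i); rewrite card_completions //.
by apply: completion_count_isomorphic => //; exact: cols_balanced.
Qed.

(** Isomorphic bands have as many completions.  Conversely two bands are each
    isomorphic to a seed, and different seeds have different counts. *)
Lemma same_completions_iso B C : valid_band B -> valid_band C ->
  same_completions B C <-> isomorphic (band_triple B) (band_triple C).
Proof.
move=> vB vC; have [i Bi] := band_index vB; have [j Cj] := band_index vC.
rewrite /same_completions (card_completions_seed vB Bi) (card_completions_seed vC Cj).
split=> [/eqP/(seeds_completion_count_inj (seed_in i) (seed_in j)) E | BC].
  by apply: isomorphic_trans Bi _; rewrite /seed_triple E; apply: isomorphic_sym.
suff -> : i = j by [].
exact: seed_iso_eq (isomorphic_trans (isomorphic_sym Bi) (isomorphic_trans BC Cj)).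
Qed.

Lemma seed_band i : exists2 B, valid_band B & band_triple B = seed_triple i.
Proof.
have [S1 S2] := seed_size (seed_in i).
have : 0 < #|bands_with (seed i).1 (seed i).2 std|.
  rewrite card_bands_with // row_fillings_std // muln_gt0 /= -has_count.
  exact: (allP seeds_have_rows _ (seed_in i)).
case/card_gt0P => B; rewrite inE => /andP[vB /and3P[/eqP E0 /eqP E1 /eqP E2]].
by exists B; rewrite /band_triple ?E0 ?E1 ?E2.
Qed.

Lemma triple_msets333 a b c : balanced a -> balanced b -> balanced c ->
  seq_mset (triple a b c) \in msets333.
Proof.
move=> ba bb bc; apply/imfsetP; exists [tuple colour_partition a; colour_partition b;
  colour_partition c] => //.
by rewrite /= inE /= !colour_partition_partitions333.
Qed.

Lemma msets333_triple M : M \in msets333 ->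
  exists a b c, [/\ balanced a, balanced b, balanced c & M = seq_mset (triple a b c)].
Proof.
case/imfsetP => -[[|P1 [|P2 [|P3 []]]]] //= sz; rewrite inE /= => /and4P[H1 H2 H3 _] ->.
have [a ba ->] := partitions333_colouring H1; have [b bb ->] := partitions333_colouring H2.
have [c bc ->] := partitions333_colouring H3; by exists a, b, c.
Qed.

Lemma mem_iso_class N M : (N \in iso_class M) = (N \in msets333) && mset_iso M N.
Proof. by rewrite !inE. Qed.

Lemma iso_class_eq s t : isomorphic s t -> iso_class (seq_mset s) = iso_class (seq_mset t).
Proof.
move=> st; apply/fsetP => N; rewrite !mem_iso_class; congr (_ && _).
rewrite -[N]seq_mset_id; apply/mset_isoP/mset_isoP => H.
  exact: isomorphic_trans (isomorphic_sym st) H.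
exact: isomorphic_trans st H.
Qed.

Lemma iso_class_inj a b c t : balanced a -> balanced b -> balanced c ->
  iso_class (seq_mset (triple a b c)) = iso_class (seq_mset t) -> isomorphic (triple a b c) t.
Proof.
move=> ba bb bc E; have: seq_mset (triple a b c) \in iso_class (seq_mset (triple a b c)).
  rewrite mem_iso_class (triple_msets333 ba bb bc); exact/mset_isoP/isomorphic_perm/perm_refl.
by rewrite E mem_iso_class => /andP[_ /mset_isoP/isomorphic_sym].
Qed.

Definition seed_class i := iso_class (seq_mset (seed_triple i)).

Lemma seed_class_inj : injective seed_class.
Proof.
move=> i j E; have [b1 b2] := seed_balanced (seed_in i).
exact/seed_iso_eq/(iso_class_inj b1 b2 std_balanced E).
Qed.

Lemma iso_classesE : iso_classes = [fset seed_class i | i in 'I_44].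
Proof.
apply/fsetP => Y; apply/imfsetP/imfsetP => -[/= M HM ->].
  have [a [b [c [ba bb bc ->]]]] := msets333_triple HM.
  have [i j] := triple_seed_index ba bb bc.
  by exists i; [| exact: iso_class_eq j].
have [b1 b2] := seed_balanced (seed_in M).
by exists (seq_mset (seed_triple M)); [exact: triple_msets333 b1 b2 std_balanced |].
Qed.

Lemma band_class B i : valid_band B -> isomorphic (band_triple B) (seed_triple i) ->
  iso_class (band_mset B) = seed_class i.
Proof. by move=> vB j; rewrite (band_msetE vB); exact: iso_class_eq j. Qed.

Lemma FJ_class_eq B C : valid_band B -> valid_band C ->
  isomorphic (band_triple B) (band_triple C) -> FJ_class B = FJ_class C.
Proof.
move=> vB vC /same_completions_iso-/(_ vB vC)/eqP E.
by apply/setP => D; rewrite !inE /same_completions E.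
Qed.

Lemma FJ_class_mem B C : valid_band B -> C \in FJ_class B ->
  valid_band C /\ isomorphic (band_triple B) (band_triple C).
Proof. by move=> vB; rewrite inE => /andP[vC]; rewrite same_completions_iso. Qed.

Lemma FJ_class_refl B : valid_band B -> B \in FJ_class B.
Proof. by move=> vB; rewrite inE vB /same_completions eqxx. Qed.

(** The class of multisets of an arbitrary member; the default only serves the
    empty set, which is not a class. *)
Definition class_of (X : {set band}) : {fset {mset {set {set 'I_9}}}} :=
  iso_class (band_mset (odflt (const_mx ord0) [pick B in X])).

Lemma class_of_FJ B : valid_band B -> class_of (FJ_class B) = iso_class (band_mset B).
Proof.
move=> vB; rewrite /class_of; case: pickP => [C|/(_ B)]; last by rewrite FJ_class_refl.
move=> /(FJ_class_mem vB)[vC BC]; rewrite [odflt _ _]/= (band_msetE vB) (band_msetE vC).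
exact: iso_class_eq (isomorphic_sym BC).
Qed.

Lemma card_iso_classes : #|` iso_classes| = 44.
Proof.
by rewrite iso_classesE (card_imfset _ _ seed_class_inj) -cardE card_ord.
Qed.

Lemma class_of_bij :
  [/\ {in FJ_classes, forall X, class_of X \in iso_classes},
      {in FJ_classes &, injective class_of} &
      {in iso_classes, forall Y, exists2 X, X \in FJ_classes & class_of X = Y}].
Proof.
split=> [_ /imsetP[B vB ->] | _ _ /imsetP[B vB ->] /imsetP[C vC ->] | Y].
- rewrite inE in vB; have [i Bi] := band_index vB.
  rewrite (class_of_FJ vB) (band_class vB Bi) iso_classesE; apply/imfsetP.
  by exists i.
- rewrite inE in vB; rewrite inE in vC.
  rewrite (class_of_FJ vB) (class_of_FJ vC) (band_msetE vB) (band_msetE vC) => E.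
  apply: (FJ_class_eq vB vC).
  by apply: iso_class_inj E; exact: cols_balanced.
- rewrite iso_classesE => /imfsetP[/= i _ ->].
  have [B vB EB] := seed_band i; exists (FJ_class B).
    by apply: imset_f; rewrite inE.
  rewrite (class_of_FJ vB); apply: (band_class vB); rewrite EB.
  exact: isomorphic_perm (perm_refl _).
Qed.

Lemma card_FJ_classes : #|FJ_classes| = 44.
Proof.
have [_ inj onto] := class_of_bij.
have E : [fset class_of X | X in FJ_classes] = iso_classes.
  apply/fsetP => Y; apply/imfsetP/idP => [[/= X XF ->]|YI].
    by have [H _ _] := class_of_bij; apply: H.
  by have [X XF <-] := onto Y YI; exists X.
rewrite -card_iso_classes -E card_in_imfset ?cardE //.
Qed.

Theorem theorem2 :
  [/\ #|FJ_classes| = 44,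
      #|` iso_classes | = 44
    & exists F : {set 'M['I_9]_(3, 9)} -> {fset {mset {set {set 'I_9}}}},
        [/\ forall B : 'M['I_9]_(3, 9), valid_band B ->
              F (FJ_class B) = iso_class (band_mset B),
            {in FJ_classes, forall X, F X \in iso_classes},
            {in FJ_classes &, injective F}
          & {in iso_classes, forall Y, exists2 X, X \in FJ_classes & F X = Y}]].
Proof.
split; [exact: card_FJ_classes | exact: card_iso_classes |].
by have [H1 H2 H3] := class_of_bij; exists class_of; split=> //; apply: class_of_FJ.
Qed.
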